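(* Let $E$ be a countable Borel equivalence relation on a standard Borel space $X$. If $E$ has property $\mathsf{s}$ (i.e. $E$ is Borel non-splitting), then $E$ is smooth.
   Context: A Borel equivalence relation on a standard Borel space is countable if all its classes are countable. It is smooth if there are a standard Borel space $Y$ and a Borel map $f\colon X\to Y$ with $x\mathrel{E}x'\iff f(x)=f(x')$. If $E$, $F$ are equivalence relations on standard Borel spaces $X$, $Y$, a Borel homomorphism from $E$ to $F$, written $f\colon E\to F$, is a Borel function $f\colon X\to Y$ such that $x\mathrel{E}x'$ implies $f(x)\mathrel{F}f(x')$. $[\omega]^\omega$ is the set of infinite subsets of $\omega$, viewed as a Borel subset of $2^\omega$. $E_0([\omega]^\omega)$ is the relation of eventual equality on $[\omega]^\omega$: $A\mathrel{E_0}B$ iff the symmetric difference of $A$ and $B$ is finite. $A\subset^*B$ means $A\smallsetminus B$ is finite, and $A^c=\omega\smallsetminus A$. For a standard Borel space $Z$, $E_{\mathsf{set}}(Z)$ is the equivalence relation on $Z^\omega$ given by $\langle z_n\rangle\mathrel{E_{\mathsf{set}}(Z)}\langle z_n'\rangle$ iff $\{z_n:n\in\omega\}=\{z'_n:n\in\omega\}$. $E$ has property $\mathsf{s}$ (is Borel non-splitting) if for every Borel homomorphism $\phi\colon E\to E_{\mathsf{set}}([\omega]^\omega)$ there exists a Borel homomorphism $\psi\colon E\to E_0([\omega]^\omega)$ such that for all $x\in X$ and $n\in\omega$, $\psi(x)\subset^*\phi(x)(n)$ or $\psi(x)\subset^*\phi(x)(n)^c$. *)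

(* Defs.v *)
From mathcomp Require Import all_boot.
From mathcomp Require Import all_classical all_reals topology measure cantor.

Set Implicit Arguments.
Unset Strict Implicit.
Unset Printing Implicit Defensive.

Local Open Scope classical_set_scope.

(* A Borel space is a type [X] with an explicit set system [BX]; it is not a
   [measurableType], because those are pointed and the empty standard Borel
   space would be excluded. *)

Definition borel_fun (X Y : Type) (BX : set (set X)) (BY : set (set Y))
    (f : X -> Y) : Prop :=
  forall U, BY U -> BX (f @^-1` U).

Definition prod_borel (X Y : Type) (BX : set (set X)) (BY : set (set Y)) :
    set (set (X * Y)) :=
  <<s [set A `*` B | A in BX & B in BY] >>.

Definition seq_borel (Z : Type) (BZ : set (set Z)) : set (set (nat -> Z)) :=
  <<s \bigcup_n preimage_set_system setT (fun z : nat -> Z => z n) BZ >>.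

(* Completeness is spelled out because [completeType] is pointed. *)
Definition complete_separable (R : realType) (M : metricType R) : Prop :=
  (forall F : set_system M, ProperFilter F -> cauchy F -> exists l : M, F --> l) /\
  (exists2 D : set M, countable D & dense D).

(* [(X, BX)] is isomorphic, as a measurable space, to a Polish space with its
   Borel sets; this makes [BX] a sigma-algebra. *)
Definition standard_borel (R : realType) (X : Type) (BX : set (set X)) : Prop :=
  exists (M : metricType R) (f : X -> M),
    [/\ complete_separable M, bijective f &
        BX = preimage_set_system setT f <<s @open M >>].

Definition countable_borel_equivalence (X : Type) (BX : set (set X))
    (E : X -> X -> Prop) : Prop :=
  [/\ RelationClasses.Equivalence E,
      prod_borel BX BX [set p | E p.1 p.2] &
      forall x, countable [set y | E x y]].

Definition smooth (R : realType) (X : Type) (BX : set (set X))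
    (E : X -> X -> Prop) : Prop :=
  exists (Y : Type) (BY : set (set Y)) (f : X -> Y),
    [/\ standard_borel R BY, borel_fun BX BY f &
        forall x x', E x x' <-> f x = f x'].

Definition borel_hom (X Y : Type) (BX : set (set X)) (E : X -> X -> Prop)
    (BY : set (set Y)) (F : Y -> Y -> Prop) (f : X -> Y) : Prop :=
  borel_fun BX BY f /\ forall x x', E x x' -> F (f x) (f x').

Definition infset : Type := {A : set nat | infinite_set A}.

Definition indicator_seq (A : infset) : cantor_space := fun n => `[< sval A n >].

Definition infset_borel : set (set infset) :=
  preimage_set_system setT indicator_seq <<s @open cantor_space >>.

Definition E0_infset (A B : infset) : Prop := finite_set (sval A `+` sval B).

Definition almost_subset (A B : set nat) : Prop := finite_set (A `\` B).

Definition E_set (Z : Type) (z z' : nat -> Z) : Prop := range z = range z'.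

Definition borel_non_splitting (X : Type) (BX : set (set X))
    (E : X -> X -> Prop) : Prop :=
  forall phi : X -> nat -> infset,
    borel_hom BX E (seq_borel infset_borel) (@E_set infset) phi ->
    exists psi : X -> infset,
      borel_hom BX E infset_borel E0_infset psi /\
      forall x n, almost_subset (sval (psi x)) (sval (phi x n)) \/
                  almost_subset (sval (psi x)) (~` sval (phi x n)).

(* Main.v *)
Require Import Defs.
From mathcomp Require Import all_boot all_order all_algebra.
From mathcomp Require Import all_classical all_reals topology measure cantor.

Set Implicit Arguments.
Unset Strict Implicit.
Unset Printing Implicit Defensive.

Import Order.TTheory GRing.Theory Num.Theory.
Local Open Scope classical_set_scope.

(** Why the theorem is true.  Consider first the relation [E0] of eventual equality of
binary sequences.  To [b] attach the set [A b] of the [n] such that the sum of the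
first [n] terms of [b] is odd.  If [b] and [b'] are eventually equal, then [A b'] is
almost equal to [A b] or to its complement, so the countable family of all finite
modifications of [A b] and of its complement depends on the class of [b] only.  An
unsplit choice [psi], invariant up to finite sets, decides each [A b] one way; since
flipping one bit of [b] exchanges [A b] with its complement, the set of the [b] for
which [psi b] is almost contained in [A b] is mapped to its complement by every bit
flip.  A set with the Baire property cannot behave in this way ([no_flip_set]), so
[E0] is not Borel non-splitting.

For a general [E] the argument is run through two Borel maps: a homomorphism [k]
from [E0] to [E], and a homomorphism [r] back, such that [r (k b)] is eventually
equal to [b] ([splitting_of_E0]).  They exist as soon as [E] is not smooth, by the
Glimm-Effros dichotomy for countable Borel equivalence relations
([smooth_or_embeds_E0], [retraction]).

The dichotomy needs the Lusin-Novikov theorem: a countable Borel equivalence relation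
is a countable union of graphs of Borel functions ([lusin_novikov]).  Both are proved
with the [coding]s of a Polish space [T]: continuous maps from a closed subset of the
Baire space onto [T], with a Borel section.  Countably many Borel sets can be made
clopen in a coding ([coding_clopen]), which plays the part of a change of topology.
Together with Luzin's separation theorem this shows that an analytic function extends
to a Borel one ([analytic_function]).

Both the Lusin-Novikov theorem and the dichotomy are fusion arguments on a sigma-ideal
of sets.  For the first, a family of points in a common section that cannot be
covered by countably many Borel graphs can be enlarged by splitting one of its points
([split_alive]); iterating yields an uncountable section.  For the second, the
ideal consists of the sets covered by countably many Borel partial transversals; in a
set outside the ideal, some function of the countable family moves points within
their class and within the set, while avoiding finitely many prescribed
values ([avoid_finite]); iterating yields the copy of [E0]. *)

(** * Closure properties of sigma-algebras, for sets given by predicates *)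

Section BorelPredicates.
Variables (T : Type) (S : set (set T)).
Hypothesis saS : sigma_algebra setT S.

Lemma sa_not (P : T -> Prop) : S [set x | P x] -> S [set x | ~ P x].
Proof.
case: saS => _ sC _ /sC; congr S; apply/seteqP; split => x /=; first by case.
by move=> ?; split.
Qed.

Lemma sa_ex (I : countType) (P : I -> T -> Prop) :
  (forall i, S [set x | P i x]) -> S [set x | exists i, P i x].
Proof.
case: saS => s0 _ sU hP.
have -> : [set x | exists i, P i x] =
    \bigcup_n (if unpickle n is Some i then [set x | P i x] else set0).
  apply/seteqP; split => x /=; first by case=> i Px; exists (pickle i) => //;
      rewrite pickleK.
  by case=> n _; case: unpickle => //= i Px; exists i.
by apply: sU => n; case: unpickle.
Qed.

Lemma sa_all (I : countType) (P : I -> T -> Prop) :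
  (forall i, S [set x | P i x]) -> S [set x | forall i, P i x].
Proof.
move=> hP; have /sa_not : S [set x | exists i, ~ P i x].
  by apply: sa_ex => i; apply: sa_not; apply: hP.
congr S; apply/seteqP; split => x /=; last by move=> h [].
by move=> nP i; apply: contrapT => ?; apply: nP; exists i.
Qed.

Lemma sa_or (P Q : T -> Prop) :
  S [set x | P x] -> S [set x | Q x] -> S [set x | P x \/ Q x].
Proof.
move=> hP hQ; have : S [set x | exists b : bool, if b then P x else Q x].
  by apply: sa_ex => -[].
congr S; apply/seteqP; split => x /=; first by case=> -[]; [left|right].
by case; [exists true|exists false].
Qed.

Lemma sa_and (P Q : T -> Prop) :
  S [set x | P x] -> S [set x | Q x] -> S [set x | P x /\ Q x].
Proof.
move=> hP hQ; have : S [set x | forall b : bool, if b then P x else Q x].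
  by apply: sa_all => -[].
congr S; apply/seteqP; split => x /=.
  by move=> h; split; [exact: (h true)|exact: (h false)].
by case=> ? ? [].
Qed.

Lemma sa_imp (P Q : T -> Prop) :
  S [set x | P x] -> S [set x | Q x] -> S [set x | P x -> Q x].
Proof.
move=> hP hQ; have := sa_or (sa_not hP) hQ.
congr S; apply/seteqP; split => x /=; first by case.
by move=> h; case: (pselect (P x)) => [/h|]; [right|left].
Qed.

Lemma sa_iff (P Q : T -> Prop) :
  S [set x | P x] -> S [set x | Q x] -> S [set x | P x <-> Q x].
Proof. by move=> hP hQ; apply: sa_and; apply: sa_imp. Qed.

Lemma sa_cst (P : Prop) : S [set x | P].
Proof.
case: saS => s0 _ _.
have hF : S [set x : T | False] by [].
case: (pselect P) => p; last by move: hF; congr S; apply/seteqP; split.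
by move: (sa_not hF); congr S; apply/seteqP; split => // x _ [].
Qed.

Lemma sa_ext (P Q : T -> Prop) :
  (forall x, P x <-> Q x) -> S [set x | P x] -> S [set x | Q x].
Proof. by move=> PQ; congr S; apply/seteqP; split => x /PQ. Qed.

Definition borel_seq (A : Type) (e : T -> nat -> A) : Prop :=
  forall n a, S [set x | e x n = a].

End BorelPredicates.

Definition agree (A : Type) (n : nat) (z w : nat -> A) : Prop :=
  forall i, (i < n)%N -> z i = w i.

Section Agree.
Variable A : Type.
Implicit Types z w : nat -> A.

Lemma agree_refl n z : agree n z z. Proof. by []. Qed.

Lemma agree_sym n z w : agree n z w -> agree n w z.
Proof. by move=> h i /h. Qed.

Lemma agree_trans n z w v : agree n z w -> agree n w v -> agree n z v.
Proof. by move=> h k i ni; rewrite h// k. Qed.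

Lemma agree_le m n z w : (m <= n)%N -> agree n z w -> agree m z w.
Proof. by move=> mn h i im; apply: h; apply: leq_trans mn. Qed.

Lemma agree_mkseq n z w : agree n z w <-> mkseq z n = mkseq w n.
Proof.
split=> h; last first.
  by move=> i ni; have := congr1 (fun s => nth (z i) s i) h; rewrite !nth_mkseq.
by apply/eq_in_map => i; rewrite mem_iota => /h.
Qed.

End Agree.

(** There are only countably many strings of length [n], and a predicate of the first [n]
terms is a union of the Borel events that one of them occurs. *)
Lemma sa_agree T (S : set (set T)) (saS : sigma_algebra setT S)
    (A : countType) (e : T -> nat -> A) n (P : (nat -> A) -> Prop) :
  borel_seq S e -> (forall z w, agree n z w -> P z -> P w) ->
  S [set x | P (e x)].
Proof.
move=> be hP.
apply: (@sa_ext _ _ (fun x => exists s : seq A,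
    mkseq (e x) n = s /\ (exists2 z, mkseq z n = s & P z))).
  move=> x; split => [[s [<- [z /agree_mkseq zx Pz]]]|Px].
    exact: hP zx Pz.
  by exists (mkseq (e x) n); split=> //; exists (e x).
apply: sa_ex => // s; apply: sa_and => //; last exact: sa_cst.
apply: (@sa_ext _ _ (fun x => size s = n /\
    forall i a, (i < n)%N -> e x i = a -> nth a s i = a)).
  move=> x; split => [[sn h]|<-]; last first.
    by rewrite size_mkseq; split => // i a ni <-; rewrite nth_mkseq.
  apply: (@eq_from_nth _ (e x 0%N)); first by rewrite size_mkseq sn.
  move=> i; rewrite size_mkseq => ni; rewrite nth_mkseq// -{1}(h i (e x i) ni
      erefl).
  by apply: set_nth_default; rewrite sn.
apply: sa_and => //; first exact: sa_cst.
apply: sa_all => // i; apply: sa_all => // a; apply: sa_imp => //;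
    first exact: sa_cst.
by apply: sa_imp => //; exact: sa_cst.
Qed.

Lemma borel_comp_gen T U (S : set (set T)) (G : set (set U)) (f : T -> U) :
  sigma_algebra setT S -> (forall V, G V -> S (f @^-1` V)) ->
  forall V, <<s G >> V -> S (f @^-1` V).
Proof.
move=> saS hG V hV.
have : <<s G >> `<=` [set V | S (f @^-1` V)].
  apply: smallest_sub => //; case: saS => s0 sC sU; split.
  - by rewrite /= preimage_set0.
  - by move=> A /= /sC; rewrite !setTD preimage_setC.
  - by move=> A hA /=; rewrite preimage_bigcup; apply: sU.
by apply.
Qed.

Definition least (P : nat -> Prop) : nat :=
  if pselect (exists n, `[< P n >]) is left h then ex_minn h else 0%N.

Lemma leastP P n : P n -> P (least P).
Proof.
rewrite /least => Pn; case: pselect => [h|[]]; last by exists n; apply/asboolP.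
by case: ex_minnP => m /asboolP.
Qed.

Lemma least_le P n : P n -> (least P <= n)%N.
Proof.
rewrite /least => Pn; case: pselect => [h|//].
by case: ex_minnP => m _ hm; apply: hm; apply/asboolP.
Qed.

Lemma least0 P : (forall i, ~ P i) -> least P = 0%N.
Proof.
rewrite /least => nP; case: pselect => // h; exfalso.
by case: h => i /asboolP; apply: nP.
Qed.

Lemma least_eq P n :
  (least P = n) <->
  (P n /\ forall i, (i < n)%N -> ~ P i) \/ (n = 0%N /\ forall i, ~ P i).
Proof.
split.
  case: (pselect (exists i, P i)) => [[i Pi]|nP] <-.
    left; split; first exact: leastP Pi.
    by move=> j jl /least_le; rewrite leqNgt jl.
  right; split; last by move=> i Pi; apply: nP; exists i.
  by apply: least0 => i Pi; apply: nP; exists i.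
case=> [[Pn nP]|[-> nP]].
  apply/eqP; rewrite eqn_leq least_le// leqNgt; apply/negP => /nP.
  by apply; apply: leastP Pn.
exact: least0.
Qed.

Lemma sa_least T (S : set (set T)) (saS : sigma_algebra setT S)
    (P : nat -> T -> Prop) n :
  (forall i, S [set x | P i x]) -> S [set x | least (P ^~ x) = n].
Proof.
move=> hP; apply: sa_ext; first by move=> x; apply: iff_sym; exact: least_eq.
apply: sa_or => //; apply: sa_and => //; do ?exact: sa_cst.
  by apply: sa_all => // i; apply: sa_imp (sa_cst _ _) (sa_not _ _).
by apply: sa_all => // i; apply: sa_not.
Qed.


(** * The Baire space, its closed sets, and relatively continuous maps *)

Definition baire : Type := nat -> nat.

(** One point of the Baire space stands for a sequence of points, through a pairing of
the natural numbers; [bundle] is the inverse operation. *)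
Definition coord (i : nat) (z : baire) : baire := fun m => z (pickle (i, m)).

Definition bundle (Z : nat -> baire) : baire :=
  fun p => if @unpickle (nat * nat)%type p is Some im then Z im.1 im.2 else 0%N.

Lemma coord_bundle Z i : coord i (bundle Z) = Z i.
Proof. by apply/funext => m; rewrite /coord /bundle pickleK. Qed.

Lemma coord_agree i n : exists N, forall z w, agree N z w ->
  agree n (coord i z) (coord i w).
Proof.
exists (\max_(m < n) (pickle (i, m : nat)).+1)%N => z w h m mn.
by apply: h; apply: (leq_bigmax (Ordinal mn)).
Qed.

Lemma agree_flat (k N : nat) (z w : nat -> baire) :
  [seq mkseq (z j) N | j <- iota 0 k] = [seq mkseq (w j) N | j <- iota 0 k] ->
  forall j, (j < k)%N -> agree N (z j) (w j).
Proof.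
move=> /eq_in_map h j jk; apply/agree_mkseq; apply: h.
by rewrite mem_iota.
Qed.

Definition closedB (F : set baire) : Prop :=
  forall z, (forall n, exists2 w, F w & agree n z w) -> F z.

Definition ccont (T : topologicalType) (F : set baire) (G : baire -> T) : Prop :=
  forall z, F z -> forall U, open U -> U (G z) ->
  exists n, forall w, F w -> agree n z w -> U (G w).

Definition clopenB (F : set baire) (P : set baire) : Prop :=
  forall z, F z -> exists n, forall w, F w -> agree n z w -> (P z <-> P w).

Definition point_separated (T : topologicalType) : Prop :=
  forall x y : T, x <> y -> exists U V : set T,
    [/\ open U, open V, U x, V y & forall t, U t -> ~ V t].

Section ClosedB.
Variable T : topologicalType.
Hypothesis sepT : point_separated T.

Lemma ccont_coord (F F' : set baire) (G : baire -> T) i :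
  (forall z, F' z -> F (coord i z)) -> ccont F G -> ccont F' (G \o coord i).
Proof.
move=> FF h z /FF Fz U oU /(h _ Fz U oU)[n hn].
have [N hN] := coord_agree i n.
by exists N => w /FF Fw /hN; apply: hn.
Qed.

(** Every passage to the limit below is an instance of this lemma: a relation between
[a] and [a'] is known along approximating sequences only, and survives in the limit
because distinct points have disjoint neighbourhoods. *)
Lemma ccont_lim (F F' : set baire) (a a' : baire -> T) z z' :
  ccont F a -> ccont F' a' -> F z -> F' z' ->
  (forall n, exists w w', [/\ F w, F' w', agree n z w, agree n z' w' &
     a w = a' w']) -> a z = a' z'.
Proof.
move=> ca ca' hz hz' h; apply: contrapT => /sepT[U [V [oU oV Uz Vz' UV]]].
have [n hn] := ca z hz U oU Uz; have [m hm] := ca' z' hz' V oV Vz'.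
have [w [w' [Fw Fw' zw zw' e]]] := h (maxn n m).
have Uw : U (a w) by apply: hn => //; apply: agree_le zw; exact: leq_maxl.
apply: (UV _ Uw); rewrite e; apply: hm => //.
by apply: agree_le zw'; exact: leq_maxr.
Qed.

Lemma closedB_eq (F : set baire) (a a' : baire -> T) :
  closedB F -> ccont F a -> ccont F a' -> closedB [set z | F z /\ a z = a' z].
Proof.
move=> cF ca ca' z h; have Fz : F z.
  by apply: cF => n; have [w [Fw _] zw] := h n; exists w.
split=> //; apply: (ccont_lim ca ca' Fz Fz) => n.
by have [w [Fw ?] zw] := h n; exists w, w.
Qed.

End ClosedB.

Lemma closedB_and (F F' : set baire) :
  closedB F -> closedB F' -> closedB [set z | F z /\ F' z].
Proof.
by move=> cF cF' z h; split; [apply: cF|apply: cF'] => n;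
  have [w [? ?] ?] := h n; exists w.
Qed.

Lemma closedB_all (I : Type) (F : I -> set baire) :
  (forall i, closedB (F i)) -> closedB [set z | forall i, F i z].
Proof.
by move=> cF z h i; apply: cF => n; have [w Fw ?] := h n; exists w.
Qed.

Lemma closedB_imp (P : Prop) (F : set baire) :
  closedB F -> closedB [set z | P -> F z].
Proof.
by move=> cF z h p; apply: cF => n; have [w Fw ?] := h n; exists w => //; apply: Fw.
Qed.

Lemma closedB_coord (F : set baire) i :
  closedB F -> closedB [set z | F (coord i z)].
Proof.
move=> cF z h; apply: cF => n; have [N hN] := coord_agree i n.
by have [w Fw /hN] := h N; exists (coord i w).
Qed.

Lemma closedB_agree n z : closedB [set w | agree n w z].
Proof.
move=> w /(_ n)[v vz wv]; exact: agree_trans wv vz.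
Qed.

Lemma closedB_clopen F P : closedB F -> clopenB F P -> closedB [set z | F z /\ P z].
Proof.
move=> cF cP z h; have Fz : F z.
  by apply: cF => n; have [w [Fw _] zw] := h n; exists w.
split=> //; have [n hn] := cP z Fz.
by have [w [Fw Pw] zw] := h n; apply/(hn w).
Qed.

Lemma clopenB_not F P : clopenB F P -> clopenB F [set z | ~ P z].
Proof.
move=> cP z /cP[n hn]; exists n => w Fw zw; have [h1 h2] := hn w Fw zw.
by split=> nP p; apply: nP; [exact: h2|exact: h1].
Qed.

Lemma clopenB_coord F F' P i : (forall z, F' z -> F (coord i z)) ->
  clopenB F P -> clopenB F' [set z | P (coord i z)].
Proof.
move=> FF cP z /FF /cP [n hn]; have [N hN] := coord_agree i n.
by exists N => w /FF Fw /hN; apply: hn.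
Qed.


(** * Codings of a space by a closed subset of the Baire space *)

Definition borel_sets (T : topologicalType) : set (set T) := <<s @open T >>.
Arguments borel_sets T : clear implicits.

Lemma borelP (T : topologicalType) : sigma_algebra setT (borel_sets T).
Proof. exact: smallest_sigma_algebra. Qed.

Lemma borel_open (T : topologicalType) (U : set T) : open U -> borel_sets T U.
Proof. exact: sub_sigma_algebra. Qed.

(** [G] may code a point many times; the section [e] chooses a code in a Borel way, as the
inverse of a bijective coding would. *)
Record coding (T : topologicalType) (F : set baire) (G : baire -> T)
    (e : T -> baire) : Prop := Coding {
  coding_closed : closedB F ;
  coding_ccont : ccont F G ;
  coding_borel : borel_seq (borel_sets T) e ;
  coding_mem : forall x, F (e x) ;
  coding_section : forall x, G (e x) = x }.

Definition codable (T : topologicalType) : Prop :=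
  exists F G e, @coding T F G e.

Definition countably_based (T : topologicalType) : Prop :=
  exists U : nat -> set T, (forall i, open (U i)) /\
  forall (V : set T) x, open V -> V x -> exists i, U i x /\ U i `<=` V.

Section Codings.
Variable T : topologicalType.
Hypothesis sepT : point_separated T.
Let saT : sigma_algebra setT (borel_sets T) := borelP T.

(** The points of the new coding are the sequences of codes, one for each given coding,
that describe the same point of [T]. *)
Lemma coding_merge (F : nat -> set baire) (G : nat -> baire -> T)
    (e : nat -> T -> baire) (B : nat -> set T) :
  (forall i, coding (F i) (G i) (e i)) ->
  (forall i, clopenB (F i) (G i @^-1` B i)) ->
  exists F' G' e', coding F' G' e' /\ forall i, clopenB F' (G' @^-1` B i).
Proof.
move=> cod clo.
pose F' : set baire := [set z | forall i, F i (coord i z) /\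
    G i (coord i z) = G 0%N (coord 0%N z)].
have FF i z : F' z -> F i (coord i z) by move=> /(_ i)[].
exists F', (G 0%N \o coord 0%N), (fun x => bundle (e ^~ x)); split; last first.
  move=> i z F'z; have [n hn] := clopenB_coord (FF i) (clo i) F'z.
  exists n => w F'w /(hn w F'w) /=.
  by case: (F'z i) => _ ->; case: (F'w i) => _ ->.
split.
- have -> : F' = [set z | forall i, [set z | (F i (coord i z) /\
    F 0%N (coord 0%N z)) /\ (G i \o coord i) z = (G 0%N \o coord 0%N) z] z].
    apply/seteqP; split => z h i; first by case: (h i) => ? ?; case: (h 0%N).
    by have [[]] := h i.
  apply: closedB_all => i; apply: closedB_eq => //.
  + by apply: closedB_and; apply: closedB_coord; apply: coding_closed.
  + by apply: ccont_coord (coding_ccont (cod i)) => z [].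
  + by apply: ccont_coord (coding_ccont (cod 0%N)) => z [].
- exact: ccont_coord (FF 0%N) (coding_ccont (cod 0%N)).
- move=> p k; rewrite /bundle; case: unpickle => [[i m]|]; last exact: (sa_cst saT).
  exact: (coding_borel (cod i)).
- move=> x i; rewrite !coord_bundle !(coding_section (cod _)).
  by split=> //; apply: (coding_mem (cod i)).
- by move=> x /=; rewrite coord_bundle (coding_section (cod 0%N)).
Qed.

Definition shift (z : baire) : baire := fun i => z i.+1.
Definition push (a : nat) (z : baire) : baire := fun i =>
    if i is j.+1 then z j else a.

(** A relatively open set of codes is a union of conditions on finitely many terms. *)
Lemma sa_coded (F : set baire) (e : T -> baire) (W : set baire) :
  borel_seq (borel_sets T) e -> (forall x, F (e x)) ->
  (forall z, F z -> W z -> exists n, forall w, F w -> agree n z w -> W w) ->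
  borel_sets T [set x | W (e x)].
Proof.
move=> be eF opW.
apply: (@sa_ext _ (borel_sets T) (fun x => exists n : nat, forall w, F w ->
    agree n (e x) w -> W w)).
  move=> x; split => [[n]|/(opW _ (eF x))//]; exact.
apply: (sa_ex saT) => // n; apply: (sa_agree (A := nat) (P := fun z => forall w,
    F w -> agree n z w -> W w) saT be (n := n)) => z w zw h v Fv wv.
by apply: h => //; apply: agree_trans wv.
Qed.

(** A relatively open set becomes relatively clopen once the code carries an extra first
term that is zero off the set, and on the set is the successor of a number of terms
sufficient to detect membership. *)
Lemma coding_open (F : set baire) (G : baire -> T) (e : T -> baire) (B : set T) :
  coding F G e ->
  (forall z, F z -> B (G z) -> exists n, forall w, F w -> agree n z w -> B (G w)) ->
  exists F' G' e', coding F' G' e' /\ clopenB F' (G' @^-1` B).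
Proof.
move=> [cF cG be eF Ge] opB.
pose ok n z := forall w, F w -> agree n z w -> B (G w).
pose F' : set baire := [set z | F (shift z) /\
  if z 0%N is m.+1 then ok m (shift z) else ~ B (G (shift z))].
have bB : borel_sets T [set x | B x].
  have := sa_coded (W := G @^-1` B) be eF opB.
  by congr (borel_sets _ _); apply/seteqP; split => x /=; rewrite Ge.
have shift_agree n z w : agree n.+1 z w -> agree n (shift z) (shift w).
  by move=> h i ni; apply: h.
have clo : clopenB F' ((G \o shift) @^-1` B).
  move=> z [Fz z0]; exists 1%N => w [Fw w0] /(_ 0%N isT) zw /=.
  move: z0 w0; rewrite -zw; case: (z 0%N) => [|m] // hz hw.
  by split=> _; [exact: hw|exact: hz].
exists F', (G \o shift), (fun x => push (if `[< B x >] then (least (ok ^~ (e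
    x))).+1 else 0%N) (e x)).
split=> //; split.
- move=> z h; have Fz : F (shift z).
    by apply: cF => n; have [w [Fw _] /shift_agree ?] := h n.+1; exists (shift w).
  split=> //; case z0 : (z 0%N) => [|m].
    move=> /(opB _ Fz)[n hn]; have [w [Fw w0] zw] := h n.+1.
    by move: w0; rewrite -(zw 0%N)// z0; apply; apply: hn => //; apply: shift_agree.
  move=> v Fv zv; have [w [Fw w0] zw] := h m.+1.
  move: w0; rewrite -(zw 0%N)// z0; apply => //.
  by apply: agree_trans zv; apply: agree_sym; apply: shift_agree.
- move=> z [Fz _] U oU /(cG _ Fz U oU)[n hn]; exists n.+1 => w [Fw _] /shift_agree.
  exact: hn.
- case=> [|n] k /=; last exact: be.
  apply: (@sa_ext _ (borel_sets T) (fun x => (B x /\ exists j : nat, k = j.+1 /\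
      least (ok ^~ (e x)) = j) \/ (~ B x /\ k = 0%N))).
    move=> x; case: asboolP => Bx; split.
    + by case=> [[_ [j [-> ->]]]|[]].
    + by move=> <-; left; split => //; eexists.
    + by case=> [[]|[]].
    + by move=> <-; right.
  apply: (sa_or saT) => //; apply: (sa_and saT) => //; last 2 first.
  + exact: (sa_not saT).
  + exact: (sa_cst saT).
  apply: (sa_ex saT) => // j; apply: (sa_and saT) => //; first exact: (sa_cst saT).
  apply: (sa_least saT) => // m; apply: (sa_agree (A := nat) (P :=
      ok m) saT be (n := m)) => z w zw h v Fv wv.
  by apply: h => //; apply: agree_trans wv.
- move=> x; split; first exact: eF.
  rewrite /= /push /=; case: asboolP => Bx /=; last by rewrite /shift /= Ge.
  have [] := opB (e x) (eF x); first by rewrite Ge.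
  move=> n hn; exact: (@leastP (ok ^~ (e x)) n).
- by move=> x; rewrite /= /shift /= Ge.
Qed.

(** The sets that can be made clopen contain the open sets and are closed under
complement; a countable union of them is open in the merged coding, hence can
be made clopen as well. *)
Theorem coding_clopen (F0 : set baire) (G0 : baire -> T) (e0 : T -> baire)
    (B : nat -> set T) :
  coding F0 G0 e0 -> (forall i, borel_sets T (B i)) ->
  exists F G e, coding F G e /\ forall i, clopenB F (G @^-1` B i).
Proof.
move=> cod0 bB.
pose ok (B : set T) := exists F G e, coding F G e /\ clopenB F (G @^-1` B).
have okmerge (C : nat -> set T) : (forall i, ok (C i)) ->
    exists F G e, coding F G e /\ forall i, clopenB F (G @^-1` C i).
  move=> /choice[F /choice[G /choice[e h]]].
  by apply: (@coding_merge F G e) => i; case: (h i).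
apply: (okmerge B) => i.
suff : borel_sets T `<=` ok by apply.
apply: smallest_sub => [|U oU]; last first.
  by apply: (coding_open cod0) => z Fz; apply: (coding_ccont cod0).
split.
- by exists F0, G0, e0; split => // z Fz; exists 0%N.
- move=> A [F [G [e [cod cA]]]]; exists F, G, e; split => // z Fz.
  have [n hn] := clopenB_not cA Fz; exists n => w Fw zw.
  by have [h1 h2] := hn w Fw zw; split=> -[_ ?]; split=> //; [apply: h1|apply: h2].
- move=> A /okmerge[F [G [e [cod cA]]]]; apply: (coding_open cod) => z Fz [j _ Aj].
  have [n hn] := cA j z Fz; exists n => w Fw zw; exists j => //.
  by apply/(hn w Fw zw).
Qed.

End Codings.

(** * Separation and extension of analytic functions *)

(** The limit of a sequence of points in which the first [n.+1] terms are settled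
from stage [n.+1] on. *)
Definition diagonal (A : Type) (p : nat -> nat -> A) : nat -> A := fun i =>
    p i.+1 i.

Lemma diagonal_agree (A : Type) (p : nat -> nat -> A) (N : nat -> nat) :
  (forall n, (n <= N n)%N) -> (forall n, (N n <= N n.+1)%N) ->
  (forall n, agree (N n) (p n) (p n.+1)) ->
  forall n, agree (N n) (diagonal p) (p n).
Proof.
move=> Nn Ninc hp.
have Nmono m n : (m <= n)%N -> (N m <= N n)%N.
  by move=> mn; apply: (@homo_leq _ N leq) => //; exact: leq_trans.
have coh n k : agree (N n) (p n) (p (n + k)%N).
  elim: k => [|k IH]; first by rewrite addn0.
  rewrite addnS; apply: agree_trans IH _; apply: agree_le (hp _).
  by apply: Nmono; exact: leq_addr.
move=> n i iN; rewrite /diagonal; have [ni|ni] := leqP n i.+1.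
  by rewrite -(subnKC ni) -(coh n _ i iN).
rewrite -(subnKC (ltnW ni)) -(coh i.+1) //; exact: leq_trans (Nn i.+1).
Qed.

Lemma dep_choice (A : Type) (P : nat -> A -> Prop) (Q : nat -> A -> A -> Prop) a0 :
  P 0%N a0 -> (forall n a, P n a -> exists b, P n.+1 b /\ Q n a b) ->
  exists f : nat -> A, [/\ f 0%N = a0, forall n, P n (f n) & forall n,
      Q n (f n) (f n.+1)].
Proof.
move=> P0 step.
have /choice[g hg] : forall na : nat * A, exists b, P na.1 na.2 ->
    P na.1.+1 b /\ Q na.1 na.2 b.
  move=> [n a]; case: (pselect (P n a)) => [/step[b hb]|nP]; first by exists b.
  by exists a.
pose f := fix f n := if n is m.+1 then g (m, f m) else a0.
have Pf n : P n (f n) by elim: n => //= n /(hg (n, f n))[].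
by exists f; split => // n; case: (hg (n, f n) (Pf n)).
Qed.

Section Separation.
Variable T : topologicalType.
Hypothesis sepT : point_separated T.
Let saT : sigma_algebra setT (borel_sets T) := borelP T.

(** If the images could not be separated, neither could those of two cylinders of
length one, and so on; the two branches obtained in this way have distinct images,
and disjoint neighbourhoods of these separate the images of two long cylinders. *)
Theorem luzin_separation (C C' : set baire) (a a' : baire -> T) :
  closedB C -> closedB C' -> ccont C a -> ccont C' a' ->
  (forall z w, C z -> C' w -> a z <> a' w) ->
  exists B, [/\ borel_sets T B, forall z, C z -> B (a z) & forall w, C' w ->
      ~ B (a' w)].
Proof.
move=> cC cC' ca ca' disj.
pose sep n z w := exists B, [/\ borel_sets T B,
  forall v, C v -> agree n z v -> B (a v) & forall v, C' v -> agree n w v ->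
      ~ B (a' v)].
apply: contrapT => nsep.
pose upd n (z : baire) k : baire := fun i => if i == n then k else z i.
have step n zw : ~ sep n zw.1 zw.2 -> exists zw', ~ sep n.+1 zw'.1 zw'.2 /\
   (agree n zw.1 zw'.1 /\ agree n zw.2 zw'.2).
  case: zw => z w /= ns; apply: contrapT => h; apply: ns.
  have hsep kl : sep n.+1 (upd n z kl.1) (upd n w kl.2).
    apply: contrapT => nh; apply: h; exists (upd n z kl.1, upd n w kl.2);
        split => //=.
    by split => i; rewrite /upd ltn_neqAle => /andP[/negbTE ->].
  have {hsep} /choice[B hB] := hsep.
  have upd_agree v u : agree n v u -> agree n.+1 (upd n v (u n)) u.
    by move=> vu i; rewrite /upd ltnS leq_eqVlt; case: eqP => [->//|_ /= /vu].
  exists [set x | exists k, forall l, B (k, l) x]; split.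
  - apply: (sa_ex saT) => k; apply: (sa_all saT) => l; by case: (hB (k, l)).
  - move=> v Cv zv; exists (v n) => l; case: (hB (v n, l)) => _ h1 _.
    by apply: h1 => //; exact: upd_agree.
  - move=> v Cv wv [k /(_ (v n))]; case: (hB (k, v n)) => _ _ h1.
    by apply: h1 => //; exact: upd_agree.
have [f [_ nf hf]] : exists f : nat -> baire * baire, [/\ f 0%N = (fun _ => 0%N,
    fun _ => 0%N),
    forall n, ~ sep n (f n).1 (f n).2 & forall n, agree n (f n).1 (f n.+1).1 /\
        agree n (f n).2 (f n.+1).2].
  apply: (@dep_choice (baire * baire) (fun n zw => ~ sep n zw.1 zw.2)
    (fun n zw zw' => agree n zw.1 zw'.1 /\ agree n zw.2 zw'.2)) => //.
  by move=> [B [bB h1 h2]]; apply: nsep; exists B; split => // v Cv;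
      [exact: h1|exact: h2].
pose z := diagonal (fun n => (f n).1); pose w := diagonal (fun n => (f n).2).
have zf n : agree n (f n).1 z.
  by apply: agree_sym; apply: (@diagonal_agree _ _ id) => // m; case: (hf m).
have wf n : agree n (f n).2 w.
  by apply: agree_sym; apply: (@diagonal_agree _ _ id) => // m; case: (hf m).
have Cz : C z.
  apply: cC => n; apply: contrapT => h; apply: (nf n); exists set0; split => //.
  - exact: (sa_cst saT False).
  - move=> v Cv zv; apply: h; exists v => //.
    by apply: agree_trans zv; apply: agree_sym.
  - by move=> v _ _ [].
have Cw : C' w.
  apply: cC' => k; apply: contrapT => h; apply: (nf k); exists setT; split => //.
  - exact: (sa_cst saT True).
  - move=> v Cv wv; case: h; exists v => //.
    by apply: agree_trans wv; apply: agree_sym.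
have [U [V [oU oV Uz Vw UV]]] := sepT (disj z w Cz Cw).
have [n hn] := ca z Cz U oU Uz; have [m hm] := ca' w Cw V oV Vw.
apply: (nf (maxn n m)); exists U; split.
- exact: borel_open.
- move=> v Cv zv; apply: hn => //; apply: (agree_le (leq_maxl n m)).
  by apply: agree_trans zv; apply: agree_sym; exact: zf.
- move=> v Cv wv Uv; apply: (UV _ Uv); apply: hm => //.
  apply: (agree_le (leq_maxr n m)).
  by apply: agree_trans wv; apply: agree_sym; exact: wf.
Qed.

Definition borel_map (u : T -> T) : Prop := forall U, open U ->
    borel_sets T (u @^-1` U).

Lemma borel_map_pre u B : borel_map u -> borel_sets T B -> borel_sets T (u @^-1` B).
Proof. by move=> bu; apply: borel_comp_gen. Qed.

Lemma borel_map_id : borel_map id.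
Proof. by move=> U; exact: borel_open. Qed.

Lemma borel_map_comp u v : borel_map u -> borel_map v -> borel_map (u \o v).
Proof. by move=> bu bv U oU; apply: (borel_map_pre bv (bu _ oU)). Qed.

Lemma borel_map_if (P : set T) u v : borel_sets T P -> borel_map u -> borel_map v ->
  borel_map (fun x => if pselect (P x) then u x else v x).
Proof.
move=> bP bu bv U oU.
apply: (@sa_ext _ (borel_sets T) (fun x => (P x /\ U (u x)) \/ (~ P x /\ U (v x)))).
  move=> x /=; case: pselect => Px; first by split; [case=> -[]|left].
  by split; [case=> -[]|right].
apply: (sa_or saT); apply: (sa_and saT);
    [exact: bP|exact: bu|exact: (sa_not saT)|exact: bv].
Qed.

Hypothesis codT : codable T.

(** The functional hypothesis makes the sets of base points whose value has a code with
[n]-th term [i] disjoint for distinct [i], so they are separated by Borel sets [B].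
A code of the value is then read off Borel conditions on the base point, and where
these fail to define a code the map is completed by the identity. *)
Theorem analytic_function (C : set baire) (a b : baire -> T) :
  closedB C -> ccont C a -> ccont C b ->
  (forall z w, C z -> C w -> a z = a w -> b z = b w) ->
  exists u, borel_map u /\ forall z, C z -> b z = u (a z).
Proof.
move=> cC ca cb fC.
have [F0 [G0 [e0 cod0]]] := codT.
pose Q (p : nat) : set T := [set y | let ni := odflt (0,
    0)%N (@unpickle (nat * nat)%type p) in e0 y ni.1 = ni.2].
have [F1 [G1 [e1 [cod1 clo1]]]] : exists F G e, coding F G e /\ forall i,
    clopenB F (G @^-1` Q i).
  by apply: (coding_clopen sepT cod0) => i; apply: (coding_borel cod0).
pose C1 : set baire := [set z | (C (coord 0 z) /\ F1 (coord 1 z)) /\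
    G1 (coord 1 z) = b (coord 0 z)].
have cC1 : closedB C1.
  apply: (@closedB_eq _ sepT _ (G1 \o coord 1) (b \o coord 0)).
  - by apply: closedB_and; apply: closedB_coord => //; exact: coding_closed cod1.
  - by apply: ccont_coord (coding_ccont cod1) => z [].
  - by apply: ccont_coord cb => z [].
pose D n i : set baire := [set z | C1 z /\ e0 (G1 (coord 1 z)) n = i].
have cD n i : closedB (D n i).
  apply: closedB_clopen => //.
  have := clopenB_coord (F' := C1) (i := 1%N) _ (clo1 (pickle (n, i))).
  by rewrite /Q pickleK; apply => z [[]].
have caD n i : ccont (D n i) (a \o coord 0).
  by apply: ccont_coord ca => z [[[]]].
have /choice[B hB] : forall nij : nat * nat * nat, exists B, borel_sets T B /\
    (nij.1.2 <> nij.2 -> (forall z, D nij.1.1 nij.1.2 z -> B (a (coord 0 z))) /\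
    (forall w, D nij.1.1 nij.2 w -> ~ B (a (coord 0 w)))).
  move=> [[n i] j] /=; case: (pselect (i = j)) => ij.
    by exists setT; split => //; exact: (sa_cst saT True).
  have [] := luzin_separation (cD n i) (cD n j) (caD n i) (caD n j).
    move=> z w [[[Cz _] bz] iz] [[[Cw _] bw] jw] aa.
    by apply: ij; rewrite -iz -jw bz bw (fC _ _ Cz Cw aa).
  by move=> B [bB h1 h2]; exists B.
(* On the base points of [C], [P n i] selects the [n]-th term of the code of the value. *)
pose P n i x := forall j : nat, i <> j -> B (n, i, j) x.
pose v x : baire := fun n => least (P n ^~ x).
have bv : borel_seq (borel_sets T) v.
  move=> n k; apply: (sa_least saT) => i; apply: (sa_all saT) => j.
  by apply: (sa_imp saT); [exact: (sa_cst saT)|case: (hB (n, i, j))].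
have vE z : C z -> v (a z) = e0 (b z).
  move=> Cz; apply/funext => n.
  pose zz := bundle (fun i => if i == 0%N then z else e1 (b z)).
  have c0 : coord 0 zz = z by rewrite coord_bundle.
  have c1 : coord 1 zz = e1 (b z) by rewrite coord_bundle.
  have Dz : D n (e0 (b z) n) zz.
    rewrite /D /C1 /= c0 c1 (coding_section cod1); do 2?split => //; split => //.
    exact: coding_mem cod1 _.
  have Pz : P n (e0 (b z) n) (a z).
    by move=> j /(proj2 (hB (n, _, j)))[/(_ zz Dz)]; rewrite c0.
  apply: contrapT => ne; have := @leastP (P n ^~ (a z)) _ Pz.
  move=> /(_ _ ne); rewrite -/(v (a z) n).
  by move: (proj2 (hB (n, v (a z) n, e0 (b z) n)) ne) => [_ /(_ zz Dz)]; rewrite c0.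
have bF0 : borel_sets T [set x | F0 (v x)].
  apply: (@sa_ext _ (borel_sets T) (fun x => forall n : nat, exists2 w, F0 w &
      agree n (v x) w)).
    by move=> x; split => [/(coding_closed cod0)//|Fx n]; exists (v x).
  apply: (sa_all saT) => n.
  apply: (sa_agree (A := nat) (P := fun z => exists2 w, F0 w &
      agree n z w) saT bv (n := n)).
  by move=> z w zw [w' Fw' zw']; exists w' => //; apply: agree_trans zw';
      exact: agree_sym.
exists (fun x => if pselect (F0 (v x)) then G0 (v x) else x); split; last first.
  move=> z Cz; rewrite vE//; case: pselect => [?|[]]; last exact: coding_mem cod0 _.
  by rewrite (coding_section cod0).
move=> U oU.
apply: (@sa_ext _ (borel_sets T) (fun x => (F0 (v x) /\ exists n : nat,
    forall w, F0 w -> agree n (v x) w -> U (G0 w)) \/ (~ F0 (v x) /\ U x))).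
  move=> x /=; case: pselect => Fx; split; last by right.
  - by case=> [[_ [n h]]|[]//]; exact: h.
  - by move=> Ux; left; split => //; apply: (coding_ccont cod0).
  - by case=> -[].
apply: (sa_or saT); apply: (sa_and saT) => //.
- apply: (sa_ex saT) => n.
  apply: (sa_agree (A := nat) (P := fun z => forall w, F0 w -> agree n z w ->
      U (G0 w)) saT bv (n := n)).
  by move=> z w zw h w' Fw' zw'; apply: h => //; apply: agree_trans zw'.
- exact: (sa_not saT).
- exact: borel_open.
Qed.

End Separation.

Section ProductCoding.
Variable T : topologicalType.
Hypothesis sepT : point_separated T.

Lemma separated_prod : point_separated (T * T)%type.
Proof.
have h1 (x y : T * T) : x.1 <> y.1 -> exists U V : set (T * T),
    [/\ open U, open V, U x, V y & forall t, U t -> ~ V t].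
  move=> /sepT[U [V [oU oV Ux Vy UV]]]; exists (fst @^-1` U), (fst @^-1` V).
  split => //; try (by apply: open_comp => // ? _; exact: cvg_fst).
  by move=> t; exact: UV.
have h2 (x y : T * T) : x.2 <> y.2 -> exists U V : set (T * T),
    [/\ open U, open V, U x, V y & forall t, U t -> ~ V t].
  move=> /sepT[U [V [oU oV Ux Vy UV]]]; exists (snd @^-1` U), (snd @^-1` V).
  split => //; try (by apply: open_comp => // ? _; exact: cvg_snd).
  by move=> t; exact: UV.
move=> [x1 x2] [y1 y2] ne; case: (pselect (x1 = y1)) => e1; last exact: h1.
by apply: h2 => /= e2; apply: ne; rewrite e1 e2.
Qed.

Lemma prod_borel_sub : prod_borel (borel_sets T) (borel_sets T) `<=` borel_sets
    (T * T)%type.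
Proof.
apply: smallest_sub; first exact: borelP.
move=> _ [A bA [B bB <-]]; have saP := borelP (T * T)%type.
apply: (sa_and saP (P := fun p => A p.1) (Q := fun p => B p.2)).
  apply: (borel_comp_gen saP _ bA) => V oV; apply: borel_open.
  by apply: open_comp => // ? _; exact: cvg_fst.
apply: (borel_comp_gen saP _ bB) => V oV; apply: borel_open.
by apply: open_comp => // ? _; exact: cvg_snd.
Qed.

(** This is what makes Borel subsets of the square, such as graphs and equivalence
relations, accessible to [coding_clopen]. *)
Lemma coding_prod F G (e : T -> baire) : coding F G e ->
  codable (T * T)%type.
Proof.
move=> cod.
exists [set z | F (coord 0 z) /\ F (coord 1 z)], (fun z => (G (coord 0 z),
    G (coord 1 z))),
  (fun p => bundle (fun i => if i == 0%N then e p.1 else e p.2)).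
split.
- by apply: closedB_and; apply: closedB_coord; exact: coding_closed cod.
- move=> z [F0 F1] U; rewrite openE => oU /oU; rewrite /interior /=.
  case=> -[A B] /= [nA nB] AB.
  move: nA nB; rewrite !nbhsE => -[A' [oA A'z] A'A] [B' [oB B'z] B'B].
  have [n hn] := coding_ccont cod F0 oA A'z.
  have [m hm] := coding_ccont cod F1 oB B'z.
  have [N0 h0] := coord_agree 0 n; have [N1 h1] := coord_agree 1 m.
  exists (maxn N0 N1) => w [Fw0 Fw1] zw; apply: AB; split => /=.
    by apply: A'A; apply: hn => //; apply: h0; apply: agree_le zw; exact: leq_maxl.
  by apply: B'B; apply: hm => //; apply: h1; apply: agree_le zw; exact: leq_maxr.
- move=> p k; rewrite /bundle; case: unpickle => [[i m]|] /=;
    last exact: (sa_cst (borelP _)).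
  have saP := borelP (T * T)%type.
  case: (i == 0%N).
    apply: (@borel_comp_gen (T * T) T (borel_sets _) open fst saP _ _
        (coding_borel cod m k)) => V oV.
    by apply: borel_open; apply: open_comp => // ? _; exact: cvg_fst.
  apply: (@borel_comp_gen (T * T) T (borel_sets _) open snd saP _ _
      (coding_borel cod m k)) => V oV.
  by apply: borel_open; apply: open_comp => // ? _; exact: cvg_snd.
- by move=> x; rewrite /= !coord_bundle /=; split; exact: coding_mem cod _.
- by move=> [x y]; rewrite /= !coord_bundle /= !(coding_section cod).
Qed.

End ProductCoding.

(** * Polish spaces have a coding and a countable base *)

Lemma countable_enum (A : Type) (B : set A) a0 :
  countable B -> B a0 -> exists d : nat -> A, B `<=` range d.
Proof.
move=> /countable_injP[f hf] Ba0.
exists (fun n => if pselect (exists2 x, B x &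
    f x = n) is left h then projT1 (cid2 h) else a0).
move=> x Bx; exists (f x) => //; case: pselect => [h|[]]; last by exists x.
by case: cid2 => y By /= fy; apply: hf; rewrite ?inE.
Qed.

Section PolishCoding.
Variables (R : realType) (M : metricType R).
Hypothesis complM : complete_separable M.
Variable x0 : M.
Local Open Scope ring_scope.

Lemma separated_metric : point_separated M.
Proof.
move=> x y xy; have := @metric_hausdorff R M; rewrite open_hausdorff => /(_ x y).
case; first exact/eqP.
move=> [U V] /= [Ux Vy] [oU oV UV]; exists U, V; split => //; do ?exact: set_mem.
by move=> t Ut Vt; move/eqP: UV => UV; have : (U `&` V) t by []; rewrite UV.
Qed.

Let eps (i : nat) : R := i.+1%:R^-1.

Lemma eps_gt0 i : 0 < eps i. Proof. by rewrite invr_gt0. Qed.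

Lemma eps_small (d : R) : 0 < d -> exists n, forall i, (n <= i)%N -> eps i < d.
Proof.
move=> d0; have [n hn] : exists n : nat, d^-1 < n%:R.
  by exists (Num.Def.archi_bound d^-1); apply: archi_boundP; rewrite invr_ge0 ltW.
exists n => i ni; rewrite /eps invf_plt ?posrE//.
by apply: lt_le_trans hn _; rewrite ler_nat; exact: leqW.
Qed.

Lemma dense_seq : exists d : nat -> M, forall x i, exists k, mdist x (d k) < eps i.
Proof.
have [_ [D cD dD]] := complM.
have D0 : D !=set0.
  by have := dD setT; rewrite setTI; apply; [exists x0|exact: openT].
have [d0 Dd0] := D0; have [d hd] := countable_enum cD Dd0.
exists d => x i; have := dD (ball x (eps i))°.
case; first by exists x; apply: nbhsx_ballx; exact: eps_gt0.
  exact: open_interior.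
move=> y [By Dy]; have [k _ ky] := hd _ Dy; exists k; rewrite ky.
by have := interior_subset By; rewrite ballEmdist.
Qed.

(** A code of [x] is a sequence of indices of points of a dense sequence, the [i]-th of
which is within [eps i] of [x]. *)
Lemma coding_metric : codable M.
Proof.
have [d hd] := dense_seq; have [cplM _] := complM.
pose F : set baire := [set z | forall i j,
    mdist (d (z i)) (d (z j)) <= eps i + eps j].
have /choice[G hG] : forall z : baire, exists x, F z -> forall i,
    mdist x (d (z i)) <= eps i.
  move=> z; case: (pselect (F z)) => [Fz|]; last by exists x0.
  have [] := cplM ((fun n => d (z n)) @ \oo) _.
    apply: cauchy_exP => e e0; have [n hn] := eps_small (divr_gt0 e0 (ltr0n R 2)).
    exists (d (z n)); exists n => //= m nm; rewrite ballEmdist /=.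
    apply: le_lt_trans (Fz n m) _; rewrite [ltRHS]splitr; apply: ltrD; exact: hn.
  move=> l hl; exists l => _ i; apply/ler_addgt0Pr => e e0.
  have e2 : 0 < e / 2 by rewrite divr_gt0.
  have [n hn] := eps_small e2.
  have := hl (ball l (e / 2)) (nbhsx_ballx _ _ e2).
  case=> m _ hm; have := hm (maxn n m) (leq_maxr _ _);
      rewrite /= ballEmdist /= => lm.
  apply: le_trans (metric_triangle _ (d (z (maxn n m))) _) _.
  apply: le_trans (lerD (ltW lm) (Fz _ i)) _.
  rewrite addrA addrC lerD2l [leRHS]splitr lerD2l ltW//; apply: hn; exact: leq_maxl.
have eq_small x y : (forall i, mdist x y <= eps i + eps i) -> x = y.
  move=> h; apply: mdist_positivity; apply/eqP; rewrite eq_le mdist_ge0 andbT.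
  apply/ler_addgt0Pr => e e0; rewrite add0r.
  have [n hn] := eps_small (divr_gt0 e0 (ltr0n R 2)).
  by apply: le_trans (h n) _; rewrite [leRHS]splitr; apply: lerD; apply: ltW;
      apply: hn.
pose e (x : M) : baire := fun i => least (fun k => mdist x (d k) < eps i).
have he x i : mdist x (d (e x i)) < eps i.
  by have [k hk] := hd x i; apply: (leastP (P := fun k =>
      mdist x (d k) < eps i)) hk.
have Fe x : F (e x).
  move=> i j; apply: le_trans (metric_triangle _ x _) _; apply: lerD;
      apply: ltW => //.
  by rewrite metric_sym.
exists F, G, e; split => //.
- move=> z h i j; have [w Fw zw] := h (maxn i j).+1.
  by rewrite !zw ?ltnS ?leq_maxl ?leq_maxr.
- move=> z Fz U oU Uz.
  have : nbhs (G z) U by move: oU; rewrite openE; apply.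
  rewrite -filter_from_ballE => -[r /= r0 rU].
  have [n hn] := eps_small (divr_gt0 r0 (ltr0n R 2)).
  exists n.+1 => w Fw zw; apply: rU; rewrite ballEmdist /=.
  apply: le_lt_trans (metric_triangle _ (d (z n)) _) _.
  rewrite [ltRHS]splitr; apply: ltrD; first by apply: le_lt_trans (hG z Fz n)
      (hn n _).
  by rewrite metric_sym zw//; apply: le_lt_trans (hG w Fw n) (hn n _).
- move=> n k; apply: (sa_least (borelP _)) => i.
  apply: borel_open; have -> : [set x | mdist x (d i) < eps n] = ball (d i) (eps n).
    by apply/seteqP; split => x; rewrite ballEmdist /= metric_sym.
  rewrite openE => x; rewrite ballEmdist /interior /= => h.
  rewrite -filter_from_ballE; exists (eps n - mdist (d i) x);
      first by rewrite /= subr_gt0.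
  move=> y; rewrite ballEmdist /= => h'.
  by apply: le_lt_trans (metric_triangle _ x _) _; rewrite -ltrBrDl.
- move=> x; apply: eq_small => i; apply: le_trans (metric_triangle _ (d (e x
    i)) _) _.
  apply: lerD; first exact: hG.
  by rewrite metric_sym ltW.
Qed.

Lemma countable_basis : countably_based M.
Proof.
have [d hd] := dense_seq.
exists (fun p => let ni := odflt (0, 0)%N (@unpickle (nat * nat)%type p) in
    (ball (d ni.1) (eps ni.2))°).
split=> [i|V x oV Vx]; first exact: open_interior.
have : nbhs x V by move: oV; rewrite openE; apply.
rewrite -filter_from_ballE => -[r /= r0 rV].
have [n /(_ n (leqnn n)) hn] := eps_small (divr_gt0 r0 (ltr0n R 2)).
have [k hk] := hd x n.
exists (pickle (k, n)); rewrite pickleK /=; split.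
  have h : 0 < eps n - mdist x (d k) by rewrite subr_gt0.
  rewrite /interior -filter_from_ballE; exists (eps n - mdist x (d k)) => // y.
  rewrite !ballEmdist /= => xy; rewrite metric_sym in hk.
  by apply: le_lt_trans (metric_triangle _ x _) _;
      rewrite -ltrBrDl metric_sym (metric_sym x) in xy *.
move=> y /interior_subset; rewrite ballEmdist /= => ky; apply: rV;
    rewrite ballEmdist /=.
apply: le_lt_trans (metric_triangle _ (d k) _) _; rewrite [ltRHS]splitr.
by apply: ltrD; [exact: lt_trans hk hn|exact: lt_trans ky hn].
Qed.

End PolishCoding.

(** * Sigma-ideals *)

Record sigma_ideal (A : Type) (I : set (set A)) : Prop := SigmaIdeal {
  sideal0 : I set0 ;
  sideal_sub : forall B C, B `<=` C -> I C -> I B ;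
  sideal_cup : forall B : nat -> set A, (forall n, I (B n)) -> I (\bigcup_n B n) }.

Section SigmaIdeal.
Variables (A : Type) (I : set (set A)).
Hypothesis sI : sigma_ideal I.

Lemma sideal_split (J : countType) (H : set A) (B : J -> set A) :
  ~ I H -> (forall x, H x -> exists j, B j x) -> exists j, ~ I [set x | H x /\
      B j x].
Proof.
move=> nH HB; apply: contrapT => h; apply: nH.
apply: (sideal_sub sI) (sideal_cup sI (B := fun n =>
    if unpickle n is Some j then [set x | H x /\ B j x] else set0) _).
  by move=> x Hx; have [j Bj] := HB x Hx; exists (pickle j) => //; rewrite pickleK.
move=> n; case: unpickle => [j|]; last exact: sideal0.
by apply: contrapT => nj; apply: h; exists j.
Qed.

Lemma sideal_fiber (V : countType) (H : set A) (v : A -> V) :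
  ~ I H -> exists y, H y /\ ~ I [set x | H x /\ v x = v y].
Proof.
move=> nH; have [|c nc] := @sideal_split V H (fun c x => v x = c) nH.
  by move=> x _; exists (v x).
case: (pselect (exists y, H y /\ v y = c)) => [[y [Hy yc]]|nE].
  by exists y; rewrite yc.
case: nc; apply: (sideal_sub sI) (sideal0 sI) => x Hx.
by apply: nE; exists x.
Qed.

End SigmaIdeal.

(** * The Lusin-Novikov theorem *)

Section CountableSections.
Variable T : topologicalType.
Hypothesis sepT : point_separated T.
Hypothesis codT : codable T.
Hypothesis basisT : countably_based T.
Let saT : sigma_algebra setT (borel_sets T) := borelP T.

(** Points are determined by the basic open sets that contain them. *)
Lemma sa_eq (S : Type) (SS : set (set S)) (saS : sigma_algebra setT SS) (f g :
    S -> T) :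
  (forall U, open U -> SS (f @^-1` U)) -> (forall U, open U -> SS (g @^-1` U)) ->
  SS [set x | f x = g x].
Proof.
have [U [oU bU]] := basisT; move=> bf bg.
apply: (@sa_ext _ SS (fun x => forall i, U i (f x) <-> U i (g x))).
  move=> x; split => [h|->]; last by move=> i; split.
  apply: contrapT => /sepT[V [W [oV oW Vf Wg VW]]].
  have [i [Ui UV]] := bU _ _ oV Vf; apply: (VW (g x)) => //.
  by apply: UV; apply/h.
by apply: (sa_all saS) => i; apply: (sa_iff saS); [exact: bf|exact: bg].
Qed.

Lemma graph_borel (u : T -> T) : borel_map u ->
  prod_borel (borel_sets T) (borel_sets T) [set p | p.2 = u p.1].
Proof.
have saP : sigma_algebra setT (prod_borel (borel_sets T) (borel_sets T)) by
    exact: smallest_sigma_algebra.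
move=> bu; apply: (sa_eq saP) => U oU; apply: sub_sigma_algebra.
  exists setT; first exact: (sa_cst saT True).
  by exists U; [exact: borel_open|apply/seteqP; split => x /=; [case|split]].
exists (u @^-1` U); first exact: bu.
by exists setT; [exact: (sa_cst saT True)|apply/seteqP; split => x /=;
    [case|split]].
Qed.

Section Fusion.
Variables (F : set baire) (pi eta : baire -> T).
Hypotheses (cF : closedB F) (cpi : ccont F pi) (ceta : ccont F eta).

(** Families of codes of points that lie over the same base point; only the first [k]
terms of the infinite family matter. *)
Definition fiber_tuple (k N : nat) (z : nat -> baire) : set (nat -> baire) :=
  [set zeta | forall j, (j < k)%N ->
    [/\ F (zeta j), agree N (z j) (zeta j) & pi (zeta j) = pi (zeta 0%N)]].

(** The sigma-ideal of the fusion: one of the points of the family lies on one of countably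
many Borel graphs. *)
Definition killed (k : nat) (Z : set (nat -> baire)) : Prop :=
  exists u : nat -> T -> T, (forall n, borel_map (u n)) /\
  forall zeta, Z zeta -> exists j n, (j < k)%N /\ eta (zeta j) = u n (pi (zeta j)).

Lemma killed_ideal k : sigma_ideal (killed k).
Proof.
split.
- by exists (fun _ => id); split => // n; exact: borel_map_id.
- by move=> B C BC [u [bu h]]; exists u; split => // z /BC; exact: h.
- move=> B /choice[u hu].
  exists (fun p => if @unpickle (nat * nat)%type p is Some mn then u mn.1 mn.2
      else id); split.
    move=> n; case: unpickle => [[m l]|]; last exact: borel_map_id.
    by case: (hu m).
  move=> z [m _ Bz]; have [_ /(_ z Bz)[j [n [jk e]]]] := hu m.
  by exists j, (pickle (m, n)); rewrite pickleK.
Qed.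

(** Suppose that the enlarged families are killed by the graphs of [u].  Among the original
families that avoid these graphs, the [i]-th point is then a function of the base
point, for two different values would form an enlarged family.  This
analytic function extends to a Borel one, and together with [u] it kills the
original families. *)
Lemma split_alive k N z i : (i < k)%N -> ~ killed k (fiber_tuple k N z) ->
  ~ killed k.+1 [set zeta |
     fiber_tuple k.+1 N (fun j => if j == k then z i else z j) zeta /\
     eta (zeta i) <> eta (zeta k)].
Proof.
move=> ik alive [u [bu hu]]; apply: alive.
pose D : set (T * T) := [set p | exists n, p.2 = u n p.1].
have bD : borel_sets (T * T)%type D.
  by apply: (sa_ex (borelP _)) => n; apply: prod_borel_sub; apply: graph_borel.
have [F0 [G0 [e0 /coding_prod[F1 [G1 [e1 cod1]]]]]] := codT.
have [F2 [G2 [e2 [cod2 clo2]]]] : exists F G e, coding F G e /\ forall i : nat,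
    clopenB F (G @^-1` D).
  by apply: (coding_clopen (separated_prod sepT) cod1) => _.
have {}clo2 := clo2 0%N.
have cG2 := coding_ccont cod2.
have cG2fst : ccont F2 (fst \o G2).
  move=> v Fv U oU Uv; apply: (cG2 v Fv (fst @^-1` U)) => //.
  by apply: open_comp => // ? _; exact: cvg_fst.
have cG2snd : ccont F2 (snd \o G2).
  move=> v Fv U oU Uv; apply: (cG2 v Fv (snd @^-1` U)) => //.
  by apply: open_comp => // ? _; exact: cvg_snd.
pose C : set baire := [set c | forall j, (j < k)%N ->
  [set c | [set c | (F (coord j.*2 c) /\ F (coord 0 c)) /\
      pi (coord j.*2 c) = pi (coord 0 c)] c /\
   ([set c | agree N (coord j.*2 c) (z j)] c /\
    ([set c | (F2 (coord j.*2.+1 c) /\ F (coord j.*2 c)) /\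
        (G2 (coord j.*2.+1 c)).1 = pi (coord j.*2 c)] c /\
    ([set c | (F2 (coord j.*2.+1 c) /\ F (coord j.*2 c)) /\
        (G2 (coord j.*2.+1 c)).2 = eta (coord j.*2 c)] c /\
    [set c | F2 (coord j.*2.+1 c) /\ ~ D (G2 (coord j.*2.+1 c))] c)))] c].
have cC : closedB C.
  apply: closedB_all => j; apply: closedB_imp.
  apply: closedB_and; last apply: closedB_and; last apply: closedB_and;
      last apply: closedB_and.
  - apply: (@closedB_eq _ sepT _ (pi \o coord j.*2) (pi \o coord 0)).
    + by apply: closedB_and; apply: closedB_coord.
    + by apply: ccont_coord cpi => c [].
    + by apply: ccont_coord cpi => c [].
  - exact: (@closedB_coord [set c | agree N c (z j)] _ (@closedB_agree _ _)).
  - apply: (@closedB_eq _ sepT _ ((fst \o G2) \o coord j.*2.+1) (pi \o coord j.*2)).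
    + by apply: closedB_and; apply: closedB_coord => //; exact: coding_closed cod2.
    + by apply: ccont_coord cG2fst => c [].
    + by apply: ccont_coord cpi => c [].
  - apply: (@closedB_eq _ sepT _ ((snd \o G2) \o coord j.*2.+1) (eta \o coord
      j.*2)).
    + by apply: closedB_and; apply: closedB_coord => //; exact: coding_closed cod2.
    + by apply: ccont_coord cG2snd => c [].
    + by apply: ccont_coord ceta => c [].
  - apply: (@closedB_coord [set c | F2 c /\ ~ D (G2 c)]).
    by apply: closedB_clopen; [exact: coding_closed cod2|exact: clopenB_not].
(* [C] describes the families that avoid the graphs of [u]: an even coordinate codes a
   point of the family, the next odd one certifies, in a coding in which [D] is
   clopen, that this point is not in [D]. *)
have CD c j : C c -> (j < k)%N -> forall n,
    eta (coord j.*2 c) <> u n (pi (coord j.*2 c)).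
  move=> Cc jk n en; have [_ [_ [[_ e1'] [[_ e2'] [_ nD]]]]] := Cc j jk.
  by apply: nD; exists n; rewrite e1' e2'.
have FC c : C c -> F (coord i.*2 c) by move=> /(_ i ik)[[[]]].
have [||c c' Cc Cc' ee|v [bv hv]] := analytic_function (a :=
    pi \o coord i.*2) (b := eta \o coord i.*2) sepT codT cC.
- exact: ccont_coord FC cpi.
- exact: ccont_coord FC ceta.
- apply: contrapT => /= ne.
  pose zeta j := if j == k then coord i.*2 c' else coord j.*2 c.
  have zi : zeta i = coord i.*2 c by rewrite /zeta ltn_eqF.
  have zk : zeta k = coord i.*2 c' by rewrite /zeta eqxx.
  have z0 : zeta 0%N = coord 0 c by rewrite /zeta ltn_eqF ?double0 //;
      apply: leq_ltn_trans ik.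
  have Zz : fiber_tuple k.+1 N (fun j => if j == k then z i else z j) zeta.
    move=> j; rewrite ltnS leq_eqVlt => /predU1P[->|jk].
      rewrite zk eqxx z0; have [[[Fc _] _] [ac _]] := Cc' i ik.
      split => //; first exact: agree_sym.
      by rewrite -[LHS]ee /=; have [[_ ->]] := Cc i ik.
    rewrite /zeta (ltn_eqF jk) -/(zeta 0%N) z0; have [[[Fc _] e] [ac _]] := Cc j jk.
    by split => //; exact: agree_sym.
  have [|j [n [jk]]] := hu zeta; first by split => //; rewrite zi zk.
  move: jk; rewrite ltnS leq_eqVlt => /predU1P[->|jk]; first by rewrite zk;
      exact: CD.
  by rewrite /zeta (ltn_eqF jk); exact: CD.
exists (fun n => if n is m.+1 then u m else v); split; first by case.
move=> zeta Zz; apply: contrapT => nk.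
pose c := bundle (fun p => if odd p then e2 (pi (zeta p./2),
    eta (zeta p./2)) else zeta p./2).
have c0 j : coord j.*2 c = zeta j by rewrite coord_bundle odd_double doubleK.
have c1 j : coord j.*2.+1 c = e2 (pi (zeta j), eta (zeta j)).
  by rewrite coord_bundle /= odd_double /= uphalf_double.
have Cc : C c.
  move=> j jk; have [Fj aj ej] := Zz j jk.
  have F0z : F (zeta 0%N) by have [] := Zz 0%N (leq_ltn_trans (leq0n _) jk).
  have c00 : coord 0 c = zeta 0%N by exact: c0 0%N.
  rewrite /= c00 !c0 !c1 (coding_section cod2) /=.
  have Fe := coding_mem cod2; do 6?split => //; first exact: agree_sym.
  by move=> [n /= en]; apply: nk; exists j, n.+1.
by apply: nk; exists i, 0%N; split => //; have := hv c Cc; rewrite /= c0.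
Qed.

(** The two points obtained by splitting the [i]-th one are distinct, hence have codes with
long initial segments whose images are disjoint; one of the countably
many choices of initial segments is not killed. *)
Lemma split_step k N z i : (i < k)%N -> ~ killed k (fiber_tuple k N z) ->
  exists N' z', [/\ (N <= N')%N /\ (k < N')%N,
    forall j, (j < k)%N -> agree N (z j) (z' j), agree N (z i) (z' k),
    forall w w', F w -> F w' -> agree N' (z' i) w -> agree N' (z' k) w' ->
        eta w <> eta w' &
    ~ killed k.+1 (fiber_tuple k.+1 N' z')].
Proof.
move=> ik /(split_alive ik) alive.
set Z := (X in ~ killed _ X) in alive.
pose sep N' (zeta : nat -> baire) := forall w w', F w -> F w' ->
  agree N' (zeta i) w -> agree N' (zeta k) w' -> eta w <> eta w'.
have sI := killed_ideal k.+1.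
have [|N' aN'] := sideal_split sI (J := nat) (B := fun N' zeta => sep N' zeta /\
    (N <= N')%N /\ (k < N')%N) alive.
  move=> zeta [Zz ne]; have [Fi _ _] := Zz i (ltnW ik).
  have [Fk _ _] := Zz k (ltnSn k).
  have [U [V [oU oV Ui Vk UV]]] := sepT ne.
  have [n hn] := ceta Fi oU Ui; have [m hm] := ceta Fk oV Vk.
  exists (maxn (maxn n m) (maxn N k.+1)); split; last by split;
      rewrite !leq_max leqnn !orbT.
  move=> w w' Fw Fw' iw kw' e; apply: (UV (eta w)).
    by apply: hn => //; apply: agree_le iw; rewrite !leq_max leqnn.
  by rewrite e; apply: hm => //; apply: agree_le kw'; rewrite !leq_max leqnn !orbT.
have [z' [[Zz' [sz' NN']] az']] := sideal_fiber sI (fun zeta : nat -> baire =>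
  [seq mkseq (zeta j) N' | j <- iota 0 k.+1]) aN'.
exists N', z'; split => //.
- by move=> j jk; case: (proj1 Zz' j (ltnW jk)) => _; rewrite (ltn_eqF jk).
- by case: (proj1 Zz' k (ltnSn k)) => _; rewrite eqxx.
- apply: contra_not az'; apply: (sideal_sub sI) => zeta [[[Zz _] _] fl] j jk.
  have [Fj _ ej] := Zz j jk; split => //.
  by apply: agree_sym; exact: (agree_flat fl).
Qed.

(** Each number is the parent of arbitrarily large ones: every point of the fusion is split
infinitely often. *)
Definition parent (n : nat) : nat := logn 2 n.+1.

Lemma parent_lt n : (parent n < n.+1)%N.
Proof. exact: ltn_logl. Qed.

Lemma parent_often i n : exists l, (n <= l)%N /\ parent l = i.
Proof.
have p0 : (0 < 2 ^ i * 3 ^ n)%N by rewrite muln_gt0 !expn_gt0.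
exists (2 ^ i * 3 ^ n).-1; rewrite /parent prednK//; split.
  rewrite -ltnS prednK//; apply: leq_trans (leq_pmull _ _);
      last by rewrite expn_gt0.
  exact: ltn_expl.
by rewrite lognM ?expn_gt0// pfactorK// lognX [logn 2 3](_ : _ = 0%N) ?muln0 ?addn0.
Qed.

(** Fusion.  At stage [n] there are [n.+1] points over a common base point, and the point
number [parent n] is split to create the next one.  If a section were
enumerated by [y], descend through the splittings and at the [m]-th one keep the half
that does not contain [y m]: the limit is a point of the section that is missing
from the enumeration. *)
Theorem countable_sections :
  (forall x, countable [set y | exists2 z, F z & pi z = x /\ eta z = y]) ->
  exists u : nat -> T -> T, (forall n, borel_map (u n)) /\
    forall z, F z -> exists n, eta z = u n (pi z).
Proof.
move=> cntF; apply: contrapT => nu.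
have alive0 : ~ killed 1 (fiber_tuple 1 0 (fun=> fun=> 0%N)).
  move=> [u [bu hu]]; apply: nu; exists u; split => // z Fz.
  by have [|j [n [_ e]]] := hu (fun=> z); [|exists n].
pose P n (s : nat * (nat -> baire)) := (n <= s.1)%N /\
    ~ killed n.+1 (fiber_tuple n.+1 s.1 s.2).
pose Q n (s s' : nat * (nat -> baire)) := [/\ (s.1 <= s'.1)%N,
    forall j, (j <= n)%N -> agree s.1 (s.2 j) (s'.2 j),
        agree s.1 (s.2 (parent n)) (s'.2 n.+1) &
    forall w w', F w -> F w' -> agree s'.1 (s'.2 (parent n)) w ->
        agree s'.1 (s'.2 n.+1) w' -> eta w <> eta w'].
have [||st [_ hP hQ]] := @dep_choice _ P Q (0%N, fun=> fun=> 0%N).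
- by split.
- move=> n [N z] [/= nN alive].
  have [N' [z' [[NN' nN'] h1 h2 h3 h4]]] := split_step (parent_lt n) alive.
  by exists (N', z'); split; [split => //; exact: ltnW|split].
pose N n := (st n).1; pose z n := (st n).2.
have Nmono m n : (m <= n)%N -> (N m <= N n)%N.
  by move=> mn; apply: (@homo_leq _ N leq) => // [|k];
      [exact: leq_trans|case: (hQ k)].
have nN n : (n <= N n)%N by case: (hP n).
have coh j n l : (j <= n)%N -> (n <= l)%N -> agree (N n) (z n j) (z l j).
  move=> jn nl; rewrite -(subnKC nl); elim: (l - n)%N => [|k IH];
      first by rewrite addn0.
  rewrite addnS; apply: agree_trans IH _; have [_ h _ _] := hQ (n + k)%N.
  by apply: agree_le (h j _); [apply: Nmono;
      exact: leq_addr|apply: leq_trans jn (leq_addr _ _)].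
have ex n : exists zeta, fiber_tuple n.+1 (N n) (z n) zeta.
  apply: contrapT => h; case: (hP n) => _; apply.
  by apply: (sideal_sub (killed_ideal _)) (sideal0 (killed_ideal _)) => zeta Zz;
      case: h; exists zeta.
pose w0 := diagonal (fun n => z n 0%N).
have w0z n : agree (N n) w0 (z n 0%N).
  by apply: (@diagonal_agree _ _ N) => // m; [apply: Nmono|apply: coh].
have Fw0 : F w0.
  apply: cF => n; have [zeta Zz] := ex n; have [F0 a0 _] := Zz 0%N (ltn0Sn _).
  by exists (zeta 0%N) => //; apply: agree_le (nN n) _;
      apply: agree_trans (w0z n) a0.
pose x := pi w0.
have [y hy] : exists y : nat -> T, forall w, F w -> pi w = x -> exists m,
    y m = eta w.
  have [|y hy] := countable_enum (a0 := eta w0) (cntF x); first by exists w0.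
  by exists y => w Fw wx; have [|m _ ym] := hy (eta w); [exists w|exists m].
(* A node [(n, c)] stands for the cylinder of the point number [c] at stage [n]. *)
pose PP (m : nat) (nc : nat * nat) := (nc.2 <= nc.1)%N /\ (m <= nc.1)%N.
pose QQ (m : nat) (nc nc' : nat * nat) := [/\ (nc.1 <= nc'.1)%N,
   agree (N nc.1) (z nc.1 nc.2) (z nc'.1 nc'.2) &
   forall w, F w -> agree (N nc'.1) (z nc'.1 nc'.2) w -> eta w <> y m].
have [||nc [_ hPP hQQ]] := @dep_choice _ PP QQ (0%N, 0%N).
- by split.
- move=> m [n c] [/= cn mn].
  have [l [nl lc]] := parent_often c n.
  have [_ h1 h2 h3] := hQ l; rewrite lc in h2 h3.
  have cl : (c <= l)%N by exact: leq_trans nl.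
  have nc := coh c n l cn nl.
  have ag c' : agree (N l) (z l c) (z l.+1 c') -> agree (N n) (z n c) (z l.+1 c').
    by move=> h; apply: agree_trans nc _; apply: agree_le h; exact: Nmono.
  case: (pselect (exists2 w, F w & agree (N l.+1) (z l.+1 c) w /\
      eta w = y m)) => [[w Fw [cw ew]]|nw].
    exists (l.+1, l.+1); split; split => //=.
    + by rewrite ltnS; exact: leq_trans nl.
    + by rewrite leqW.
    + exact: ag.
    + by move=> w' Fw' cw'; rewrite -ew => e; apply: (h3 w w').
  exists (l.+1, c); split; split => //=.
  + by rewrite leqW.
  + by rewrite ltnS; exact: leq_trans nl.
  + by rewrite leqW.
  + by apply: ag; exact: h1.
  + by move=> w Fw cw ew; apply: nw; exists w.
pose p m := z (nc m).1 (nc m).2; pose w := diagonal p.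
have wp m : agree (N (nc m).1) w (p m).
  apply: (@diagonal_agree _ _ (fun m => N (nc m).1)) => k.
  - by apply: leq_trans (nN _); case: (hPP k).
  - by apply: Nmono; case: (hQQ k).
  - by case: (hQQ k).
have near m : exists zeta, fiber_tuple (nc m).1.+1 (N (nc m).1) (z (nc m).1) zeta /\
    [/\ F (zeta (nc m).2), F (zeta 0%N), agree m w (zeta (nc m).2),
        agree m w0 (zeta 0%N) & pi (zeta (nc m).2) = pi (zeta 0%N)].
  have [zeta Zz] := ex (nc m).1; exists zeta; split => //.
  have [F0 a0 _] := Zz 0%N (ltn0Sn _).
  have [cn mn] := hPP m; have [Fc ac ec] := Zz (nc m).2 cn.
  have mN : (m <= N (nc m).1)%N by exact: leq_trans (nN _).
  by split => //; apply: agree_le mN _; [apply: agree_trans (wp m) ac|apply: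
      agree_trans (w0z _) a0].
have Fw : F w by apply: cF => m; have [zeta [_ [Fc _ wc _ _]]] := near m;
    exists (zeta (nc m).2).
have wx : pi w = x.
  apply: (ccont_lim sepT cpi cpi) => // m.
  by have [zeta [_ [Fc F0 wc w0c e]]] := near m; exists (zeta (nc m).2), (zeta 0%N).
have [m ym] := hy w Fw wx; have [_ _ /(_ w Fw)] := hQQ m.
by move=> /(_ (agree_sym (wp m.+1))); apply.
Qed.

End Fusion.

(** Apply [countable_sections] to a coding in which [E] is clopen. *)
Theorem lusin_novikov (E : T -> T -> Prop) :
  prod_borel (borel_sets T) (borel_sets T) [set p | E p.1 p.2] ->
  (forall x, countable [set y | E x y]) ->
  exists u : nat -> T -> T, (forall n, borel_map (u n)) /\
    forall x y, E x y -> exists n, y = u n x.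
Proof.
move=> bE cE.
have [F0 [G0 [e0 /coding_prod[F1 [G1 [e1 cod1]]]]]] := codT.
have [F2 [G2 [e2 [cod2 clo2]]]] : exists F G e, coding F G e /\
    forall i : nat, clopenB F (G @^-1` [set p | E p.1 p.2]).
  by apply: (coding_clopen (separated_prod sepT) cod1) => _; exact: prod_borel_sub.
pose F : set baire := [set z | F2 z /\ E (G2 z).1 (G2 z).2].
have cF : closedB F by apply: closedB_clopen (clo2 0%N); exact: coding_closed cod2.
have FF2 : F `<=` F2 by move=> z [].
have [| | |u [bu hu]] := @countable_sections F (fst \o G2) (snd \o G2) cF.
- move=> v /FF2 Fv U oU Uv.
  have [|n hn] := coding_ccont cod2 (U := fst @^-1` U) Fv _ Uv.
    by apply: open_comp => // ? _; exact: cvg_fst.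
  by exists n => w /FF2; exact: hn.
- move=> v /FF2 Fv U oU Uv.
  have [|n hn] := coding_ccont cod2 (U := snd @^-1` U) Fv _ Uv.
    by apply: open_comp => // ? _; exact: cvg_snd.
  by exists n => w /FF2; exact: hn.
- by move=> x; apply: sub_countable (cE x); apply: subset_card_le =>
    y [z [_ Ez] [<- <-]].
exists u; split => // x y Exy; have [|n] := hu (e2 (x, y)).
  by split; [exact: coding_mem cod2 _|rewrite (coding_section cod2)].
by rewrite /= (coding_section cod2) => e; exists n.
Qed.

End CountableSections.

(** * The Glimm-Effros dichotomy for countable equivalence relations *)

Definition eventually_eq (b b' : nat -> bool) : Prop :=
  exists n, forall i, (n <= i)%N -> b i = b' i.

Lemma fin_bound (I : finType) (P : I -> nat -> Prop) :
  (forall i n m, (n <= m)%N -> P i n -> P i m) ->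
  (forall i, exists n, P i n) -> exists n, forall i, P i n.
Proof.
move=> mono /choice[f hf]; exists (\max_i f i)%N => i.
by apply: mono (hf i); exact: leq_bigmax.
Qed.

Section Transversals.
Variable T : topologicalType.
Hypothesis sepT : point_separated T.
Hypothesis codT : codable T.
Hypothesis basisT : countably_based T.
Let saT : sigma_algebra setT (borel_sets T) := borelP T.

Variable E : T -> T -> Prop.
Hypothesis equivE : RelationClasses.Equivalence E.
Variable g : nat -> T -> T.
Hypothesis bg : forall n, borel_map (g n).
Hypothesis g0 : forall x, g 0%N x = x.
Hypothesis gE : forall n x, E x (g n x).
Hypothesis Eg : forall x y, E x y -> exists n, y = g n x.

Let Erefl x : E x x. Proof. by case: equivE. Qed.
Let Esym x y : E x y -> E y x. Proof. by case: equivE => _ + _; apply. Qed.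
Let Etrans x y z : E x y -> E y z -> E x z.
Proof. by case: equivE => _ _; apply. Qed.

Definition transversal (B : set T) : Prop :=
  forall x y, B x -> B y -> E x y -> x = y.

(** The sigma-ideal of the fusion: the Borel sets in it are those on which [E] is smooth. *)
Definition small (H : set T) : Prop :=
  exists t : nat -> set T, (forall n, borel_sets T (t n) /\ transversal (t n)) /\
    forall x, H x -> exists n, t n x.

Lemma small_ideal : sigma_ideal small.
Proof.
split.
- exists (fun=> set0); split => // n; split; first exact: (sa_cst saT False).
  by move=> x y [].
- by move=> B C BC [t [ht h]]; exists t; split => // x /BC /h.
- move=> B /choice[t ht].
  exists (fun p => if @unpickle (nat * nat)%type p is Some mn then t mn.1 mn.2
      else set0); split.
    move=> n; case: unpickle => [[m l]|]; first by case: (ht m).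
    by split; [exact: (sa_cst saT False)|move=> x y []].
  move=> x [m _ Bx]; have [_ /(_ x Bx)[n tx]] := ht m.
  by exists (pickle (m, n)); rewrite pickleK.
Qed.

(** The class of [x] meets the first transversal that it meets at all in one point,
which is the value of the selector; it is found in a Borel way by running
through the functions [g]. *)
Lemma small_selector : small setT ->
  exists s, borel_map s /\ forall x y, E x y <-> s x = s y.
Proof.
move=> [t [ht cov]].
pose A n x := exists m, t n (g m x).
have EA n x y : E x y -> A n x -> A n y.
  move=> xy [m tm]; have [l hl] := Eg (Etrans (Esym xy) (gE m x)).
  by exists l; rewrite -hl.
pose N x := least (A ^~ x).
have AN x : A (N x) x.
  have [n tn] := cov x I; apply: (@leastP (A ^~ x) n).
  by exists 0%N; rewrite g0.
have NE x y : E x y -> N x = N y.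
  move=> xy; rewrite /N; congr least; apply/funext => n; apply/propext.
  by split; apply: EA => //; exact: Esym.
have /choice[s hs] : forall x, exists y, E x y /\ t (N x) y.
  by move=> x; have [m tm] := AN x; exists (g m x).
exists s; split.
- move=> U oU; apply: (@sa_ext _ (borel_sets T) (fun x => exists n, N x = n /\
    exists m, t n (g m x) /\ U (g m x))).
    move=> x; have [Exs ts] := hs x; split.
      move=> [n [<- [m [tm Um]]]] /=; suff -> : s x = g m x by [].
      by apply: (proj2 (ht (N x))) => //; apply: Etrans (Esym Exs) (gE m x).
    move=> Us; exists (N x); split => //; have [m hm] := Eg Exs.
    by exists m; rewrite -hm.
  apply: (sa_ex saT) => n; apply: (sa_and saT).
    apply: (sa_least saT) => i; apply: (sa_ex saT) => m.
    exact: (borel_map_pre (bg m) (proj1 (ht i))).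
  apply: (sa_ex saT) => m; apply: (sa_and saT); last exact: bg.
  exact: (borel_map_pre (bg m) (proj1 (ht n))).
- move=> x y; have [xs tx] := hs x; have [ys ty] := hs y; split => [xy|sxy].
    apply: (proj2 (ht (N x))) => //; first by rewrite (NE _ _ xy).
    by apply: Etrans (Esym xs) (Etrans xy ys).
  by apply: Etrans xs _; rewrite sxy; exact: Esym.
Qed.

Lemma finite_isolation (I : finType) (u : I -> T) x :
  exists U, [/\ open U, U x & forall i, U (u i) -> u i = x].
Proof.
suff [U [oU Ux h]] : exists U, [/\ open U, U x & forall i, i \in enum I ->
    U (u i) -> u i = x].
  by exists U; split => // i; apply: h; rewrite mem_enum.
elim: (enum I) => [|i s [U [oU Ux h]]]; first by exists setT; split => //;
    exact: openT.
case: (pselect (u i = x)) => [ux|/nesym /sepT[V [W [oV oW Vx Wu VW]]]].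
  by exists U; split => // j; rewrite inE => /predU1P[->//|]; exact: h.
exists (U `&` V); split => //; first exact: openI.
move=> j; rewrite inE => /predU1P[-> [_ /VW /(_ Wu)[]]|js [Uj _]].
exact: h.
Qed.

(** Off the exceptional sets, each class would meet [H] in finitely many points [u i x]
only; isolating [x] from the others by a basic open set covers what remains by
countably many Borel transversals. *)
Lemma avoid_finite (H : set T) (I : finType) (u : I -> T -> T) :
  borel_sets T H -> ~ small H -> (forall i, borel_map (u i)) ->
  exists q, ~ small [set x | H x /\ (H (g q x) /\ forall i, g q x <> u i x)].
Proof.
move=> bH nH bu; apply: contrapT => /forallNP sm; apply: nH.
have [U [oU bU]] := basisT.
pose H' : set T := [set x | H x /\ forall q, H (g q x) -> exists i, g q x = u i x].
have bH' : borel_sets T H'.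
  apply: (sa_and saT) => //; apply: (sa_all saT) => q; apply: (sa_imp saT).
    exact: (borel_map_pre (bg q) bH).
  apply: (sa_ex saT) => i; exact: (sa_eq sepT basisT saT (bg q) (bu i)).
have sH' : small H'.
  exists (fun k => [set x | H' x /\ (U k x /\ forall i, U k (u i x) ->
      u i x = x)]); split.
    move=> k; split.
      apply: (sa_and saT) => //; apply: (sa_and saT);
          first exact: (borel_open (oU k)).
      apply: (sa_all saT) => i; apply: (sa_imp saT); first exact: (bu i _ (oU k)).
      exact: (sa_eq sepT basisT saT (bu i) (@borel_map_id T)).
    move=> x y [[_ hx] [_ ix]] [[Hy _] [Uy _]] /Eg[q yq].
    have [|i ui] := hx q; first by rewrite -yq.
    by rewrite yq ui ix// -ui -yq.
  move=> x H'x; have [V [oV Vx iV]] := finite_isolation (u ^~ x) x.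
  have [k [Ux UV]] := bU _ _ oV Vx; exists k; split => //; split => // i /UV;
      exact: iV.
apply: (sideal_sub small_ideal) (sideal_cup small_ideal (B := fun n =>
    if n is q.+1 then
    [set x | H x /\ (H (g q x) /\ forall i, g q x <> u i x)] else H') _).
  move=> x Hx; case: (pselect (H' x)) => [?|nH']; first by exists 0%N.
  have [q hq] : exists q, H (g q x) /\ forall i, g q x <> u i x.
    apply: contrapT => h; apply: nH'; split => // q Hq; apply: contrapT => ni.
    by apply: h; exists q; split => // i iq; apply: ni; exists i.
  by exists q.+1.
by case=> // q; apply: contrapT; exact: sm.
Qed.

Definition E0_embedding (k : (nat -> bool) -> T) : Prop :=
  [/\ forall b U, open U -> U (k b) ->
        exists n, forall b', agree n b b' -> U (k b'),
      forall b b', eventually_eq b b' -> E (k b) (k b'),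
      forall b b', E (k b) (k b') -> eventually_eq b b' &
      injective k].

Section Embedding.
Variables (F : set baire) (G : baire -> T) (e : T -> baire).
Hypothesis cod : coding F G e.
Hypothesis cgG : forall m, ccont F (g m \o G).

(** An approximation to the embedding: for [x] in the domain, the points [ahom b x] for
the [2 ^ n] values of the first [n] bits of [b] lie in the class of [x], and the first
[alen] terms of their codes do not depend on [x]. *)
Record approx : Type := Approx {
  ahom : (nat -> bool) -> T -> T ; adom : set T ; alen : nat }.

(** The fourth clause lets [x] be recovered from [ahom s b x] by one function of the family,
uniformly in [x]; in the limit it shows that eventually equal sequences have equivalent
images. *)
Definition approx_inv (n : nat) (s : approx) : Prop :=
  [/\ forall b b', agree n b b' -> ahom s b = ahom s b',
      forall b, borel_map (ahom s b) /\ forall x, E x (ahom s b x),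
      borel_sets T (adom s) /\ ~ small (adom s),
      forall b, exists l, forall x, adom s x -> g l (ahom s b x) = x &
      (n <= alen s)%N /\ forall b x y, adom s x -> adom s y ->
        agree (alen s) (e (ahom s b x)) (e (ahom s b y))].

(** The new bit selects between [x] and [g q x].  The last clause is the source of the
injectivity and of the reduction property: if [b] and [b'] differ in the [n]-th bit, the
image of one is none of the first [n.+1] translates of the image of the other,
and this is decided by finitely many terms of the codes. *)
Definition refines (n : nat) (s s' : approx) : Prop :=
  exists q, [/\
    forall (b : nat -> bool) x, ahom s' b x = ahom s b (if b n then g q x else x),
    forall x, adom s' x -> adom s x /\ adom s (g q x),
    (alen s <= alen s')%N &
    forall (b b' : nat -> bool) m x z w, b n -> ~~ b' n -> (m <= n)%N ->
        adom s' x ->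
      F z -> F w -> agree (alen s') (e (ahom s' b x)) z ->
      agree (alen s') (e (ahom s' b' x)) w -> G z <> g m (G w)].

Let bits n (t : n.-tuple bool) : nat -> bool := nth false t.

Lemma bits_agree n (b : nat -> bool) : exists t : n.-tuple bool, agree n b (bits t).
Proof.
exists [tuple b i | i < n] => i ni.
by rewrite /bits -[i]/(nat_of_ord (Ordinal ni)) -tnth_nth tnth_mktuple.
Qed.

Lemma refine_step n s : approx_inv n s -> exists s', approx_inv n.+1 s' /\
    refines n s s'.
Proof.
case: s => h H N [/= hdep hhom [bH nH] /choice[l hl] [nN hN]].
pose J : finType := (n.+1.-tuple bool * n.+1.-tuple bool * 'I_n.+1)%type.
pose u (i : J) x := g (l (bits i.1.1)) (g i.2 (h (bits i.1.2) x)).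
have bu i : borel_map (u i).
  apply: (borel_map_comp (bg _)); apply: (borel_map_comp (bg _)).
  by case: (hhom (bits i.1.2)).
(* If [h s (g q x)] were [g m (h t x)], then [g q x] would be one of these finitely
   many points [u i x]. *)
have [q nH0] := avoid_finite bH nH bu.
set H0 := (X in ~ small X) in nH0.
have bH0 : borel_sets T H0.
  apply: (sa_and saT) => //; apply: (sa_and saT);
      first exact: (borel_map_pre (bg q) bH).
  apply: (sa_all saT) => i; apply: (sa_not saT).
  exact: (sa_eq sepT basisT saT (bg q) (bu i)).
pose h' b x := h b (if b n then g q x else x).
have h'dep b b' : agree n.+1 b b' -> h' b = h' b'.
  move=> bb; apply/funext => x; rewrite /h' (bb n)//.
  by rewrite (hdep b b')//; apply: agree_le bb.
have bh' b : borel_map (h' b).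
  rewrite /h'; case: (b n); last by case: (hhom b).
  by apply: (borel_map_comp (proj1 (hhom b)) (bg q)).
have Eh' b x : E x (h' b x).
  rewrite /h'; case: (b n); last by case: (hhom b).
  by apply: Etrans (gE q x) _; case: (hhom b).
pose sep1 (i : J) N' x := bits i.1.1 n -> ~~ bits i.1.2 n -> forall z w, F z ->
    F w ->
  agree N' (e (h' (bits i.1.1) x)) z -> agree N' (e (h' (bits i.1.2) x)) w ->
  G z <> g i.2 (G w).
have [|N' nH1] := sideal_split small_ideal (J := nat)
    (B := fun N' x => (forall i, sep1 i N' x) /\ ((N <= N')%N /\ (n < N')%N)) nH0.
  move=> x [Hx [Hq hq]].
  have [|i|N1 hN1] := @fin_bound J (fun i N' => sep1 i N' x).
  - move=> i k k' kk' h1 bi b'i z w Fz Fw az aw.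
    by apply: h1 => //; apply: agree_le kk' _.
  - case: (pselect (bits i.1.1 n /\ ~~ bits i.1.2 n)) => [[b1 b2]|nb]; last first.
      by exists 0%N => b1 b2; case: nb.
    have ne : h' (bits i.1.1) x <> g i.2 (h' (bits i.1.2) x).
      rewrite /h' b1 (negbTE b2) => eqh; apply: (hq i).
      by rewrite /u -eqh hl.
    have [V [W [oV oW Vx Wx VW]]] := sepT ne.
    have [k hk] : exists k, forall w, F w ->
        agree k (e (h' (bits i.1.1) x)) w -> V (G w).
      apply: (coding_ccont cod) => //; first exact: coding_mem cod _.
      by rewrite (coding_section cod).
    have [k' hk'] : exists k, forall w, F w ->
        agree k (e (h' (bits i.1.2) x)) w -> W (g i.2 (G w)).
      have [|k' hk'] := @cgG i.2 _ (coding_mem cod (h' (bits i.1.2) x)) W oW.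
        by rewrite /= (coding_section cod); exact: Wx.
      by exists k'.
    exists (maxn k k') => _ _ z w Fz Fw az aw ezw; apply: (VW (G z)).
      by apply: hk => //; apply: agree_le az; exact: leq_maxl.
    by rewrite ezw; apply: hk' => //; apply: agree_le aw; exact: leq_maxr.
  exists (maxn N1 (maxn N n.+1)); split; last by split;
      rewrite !leq_max leqnn !orbT.
  move=> i b1 b2 z w Fz Fw az aw; apply: (hN1 i) => //.
    by apply: agree_le az; exact: leq_maxl.
  by apply: agree_le aw; exact: leq_maxl.
(* All that has to be made constant on the new domain takes countably many values. *)
pose v x : {ffun n.+1.-tuple bool -> seq nat * nat} := [ffun t =>
  (mkseq (e (h' (bits t) x)) N', least (fun l => g l (h' (bits t) x) = x))].
have [y [[H0y [sepy [NN' nN']]] nH2]] := sideal_fiber small_ideal v nH1.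
pose H' : set T := [set x | H0 x /\ v x = v y].
have vE x b : H' x -> agree N' (e (h' b x)) (e (h' b y)) /\
    least (fun l => g l (h' b x) = x) = least (fun l => g l (h' b y) = y).
  move=> [_ /ffunP vx]; have [t bt] := bits_agree n.+1 b.
  by rewrite (h'dep _ _ bt); move: (vx t); rewrite !ffunE => -[/agree_mkseq].
exists (Approx h' H' N'); split; last first.
  exists q; split => //= [x [[? []]]|b b' m x z w bn b'n mn H'x Fz Fw az aw] //.
  have [t bt] := bits_agree n.+1 b; have [t' bt'] := bits_agree n.+1 b'.
  have := sepy (t, t', Ordinal (mn : (m < n.+1)%N));
      rewrite /sep1 /= -(bt n)// -(bt' n)//.
  move=> /(_ bn b'n z w Fz Fw); rewrite -(h'dep _ _ bt) -(h'dep _ _ bt'); apply.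
    by apply: agree_trans az; apply: agree_sym; case: (vE x b H'x).
  by apply: agree_trans aw; apply: agree_sym; case: (vE x b' H'x).
split => //=.
- split; last first.
    by apply: contra_not nH2; apply: (sideal_sub small_ideal) => x [[]].
  apply: (sa_and saT) => //.
  apply: (@sa_ext _ (borel_sets T) (fun x => forall t,
      mkseq (e (h' (bits t) x)) N' = (v y t).1 /\
      least (fun l => g l (h' (bits t) x) = x) = (v y t).2)).
    move=> x; split => [hx|<- t]; last by rewrite ffunE.
    by apply/ffunP => t; rewrite ffunE; have [-> ->] := hx t; case: (v y t).
  apply: (sa_all saT) => t; apply: (sa_and saT).
    apply: (borel_map_pre (bh' (bits t)) (B :=
        [set x | mkseq (e x) N' = (v y t).1])).
    apply: (sa_agree (A := nat) (P := fun z =>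
        mkseq z N' = (v y t).1) saT (coding_borel cod) (n := N')).
    by move=> z w /agree_mkseq ->.
  apply: (sa_least saT) => k.
  apply: (sa_eq sepT basisT saT _ (@borel_map_id T)).
  exact: (borel_map_comp (bg k) (bh' _)).
- move=> b; exists (least (fun l => g l (h' b y) = y)) => x H'x.
  have [_ <-] := vE x b H'x.
  have [k hk] := Eg (Esym (Eh' b x)).
  by apply: (@leastP (fun l => g l (h' b x) = x) k).
- split => // b x x' /(vE x b)[hx _] /(vE x' b)[hx' _].
  by apply: agree_trans hx _; apply: agree_sym.
Qed.

(** Fusion along [refine_step].  The domains need not have a common point: the codes of the
points [h n b (y n)] converge, whatever the choice of [y n] in the [n]-th domain, and
the functions [g m] are continuous on codes. *)
Theorem embed_E0 : ~ small setT -> exists k, E0_embedding k.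
Proof.
move=> nT.
have [||st [st0 hst href]] := @dep_choice _ approx_inv refines (Approx (fun=>
    id) setT 0%N).
- split => //=.
  + by move=> b; split; [exact: borel_map_id|exact: Erefl].
  + by split => //; exact: (sa_cst saT True).
  + by move=> b; exists 0%N => x _; exact: g0.
- by move=> n s /refine_step.
pose h n := ahom (st n); pose H n := adom (st n); pose N n := alen (st n).
have /choice[q hq] := href.
have h0 b x : h 0%N b x = x by rewrite /h st0.
have hS n b x : h n.+1 b x = h n b (if b n then g (q n) x else x).
  by case: (hq n) => + _ _ _; apply.
have HS n x : H n.+1 x -> H n x /\ H n (g (q n) x) by case: (hq n) => _ + _ _;
    apply.
have nN n : (n <= N n)%N by case: (hst n) => _ _ _ _ [].
have NS n : (N n <= N n.+1)%N by case: (hq n).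
have Hag n b x y : H n x -> H n y -> agree (N n) (e (h n b x)) (e (h n b y)).
  by case: (hst n) => _ _ _ _ [_ hN]; exact: hN.
have /choice[y Hy] : forall n, exists x, H n x.
  move=> n; apply: contrapT => nH; case: (hst n) => _ _ [_ ns] _ _; apply: ns.
  by apply: (sideal_sub small_ideal) (sideal0 small_ideal) => x Hx; apply: nH;
      exists x.
(* If [b] and [b'] agree from [n] on, the same functions lead from [x] down to stage
   [n]. *)
have descend n k b b' x : (forall i, (n <= i)%N -> b i = b' i) -> H (n + k)%N x ->
    exists x', [/\ H n x', h (n + k)%N b x = h n b x' &
        h (n + k)%N b' x = h n b' x'].
  move=> bb; elim: k x => [|k IH] x; first by rewrite addn0 => Hx; exists x.
  rewrite addnS => /HS[Hx Hqx]; rewrite !hS -bb ?leq_addr//.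
  by case: (b (n + k)%N); apply: IH.
pose zb b := diagonal (fun n => e (h n b (y n))).
have zbN b n : agree (N n) (zb b) (e (h n b (y n))).
  apply: (@diagonal_agree _ (fun n => e (h n b (y n))) N) => // m.
  have [//||x' [Hx' e1 _]] := descend m 1%N b b (y m.+1); first by rewrite addn1.
  by move: e1; rewrite addn1 => ->; exact: Hag.
have Fzb b : F (zb b).
  apply: (coding_closed cod) => n; exists (e (h n b (y n)));
      first exact: coding_mem cod _.
  exact: agree_le (nN n) (zbN b n).
pose k b := G (zb b).
have ksep (b b' : nat -> bool) n m : b n -> ~~ b' n -> (m <= n)%N ->
    k b <> g m (k b').
  move=> bn b'n mn; have [_ _ _ sep] := hq n.
  exact: (sep b b' m (y n.+1) (zb b) (zb b') bn b'n mn (Hy _) (Fzb _) (Fzb _)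
    (agree_sym (zbN _ _)) (agree_sym (zbN _ _))).
(* Erasing the first [n] bits does not change the class of the image. *)
have kzero n (b : nat -> bool) : E (k b) (k (fun i => (n <= i)%N && b i)).
  set b0 := (X in E _ (k X)).
  have [l hl] : exists l, forall x, H n x -> g l (h n b x) = x.
    by case: (hst n) => _ _ _ + _; apply.
  suff <- : g l (k b) = k b0 by exact: gE.
  apply: (ccont_lim sepT (@cgG l) (coding_ccont cod)) => // j.
  exists (e (h (n + j)%N b (y (n + j)%N))), (e (h (n + j)%N b0 (y (n + j)%N))).
  have jN : (j <= N (n + j)%N)%N by apply: leq_trans (nN _); exact: leq_addl.
  split; [exact: coding_mem cod _|exact: coding_mem cod _|exact: agree_le jN
      (zbN _ _)|
    exact: agree_le jN (zbN _ _)|].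
  rewrite /= !(coding_section cod).
  have [i ni||x' [Hx' -> ->]] := descend n j b b0 (y (n + j)%N);
      first by rewrite /b0 ni.
    exact: Hy.
  rewrite hl//.
  suff zero m c : (forall i, (i < m)%N -> c i = false) -> h m c x' = x'.
    by rewrite zero// => i ni; rewrite /b0 leqNgt ni.
  by elim: m => [|m IH] hc; rewrite ?h0// hS hc// IH// => i im; apply: hc;
      exact: ltnW.
exists k; split.
- move=> b U oU /(coding_ccont cod (Fzb b) oU)[n hn]; exists n => b' bb'.
  apply: hn => // i ni; rewrite /zb /diagonal.
  have [hdep _ _ _ _] := hst i.+1.
  by rewrite /h (hdep b b')//; exact: agree_le bb'.
- move=> b b' [n bb']; apply: Etrans (kzero n b) _; apply: Esym.
  have -> : (fun i => (n <= i)%N && b i) = (fun i => (n <= i)%N && b' i).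
    by apply/funext => i; case: leqP => //= /bb' ->.
  exact: kzero.
- move=> b b' Ebb'; have [m hm] := Eg Ebb'; have [m' hm'] := Eg (Esym Ebb').
  exists (maxn m m') => i; rewrite geq_max => /andP[mi m'i].
  case bi : (b i); case b'i : (b' i) => //.
    by case: (@ksep b b' i m'); rewrite ?bi ?b'i.
  by case: (@ksep b' b i m); rewrite ?bi ?b'i.
- move=> b b' kbb'; apply/funext => i.
  case bi : (b i); case b'i : (b' i) => //.
    by case: (@ksep b b' i 0%N); rewrite ?bi ?b'i// g0.
  by case: (@ksep b' b i 0%N); rewrite ?bi ?b'i// g0.
Qed.

End Embedding.

(** The functions [g m] become continuous in a coding where the preimages under them
of the basic open sets are clopen. *)
Theorem smooth_or_embeds_E0 :
  (exists s, borel_map s /\ forall x y, E x y <-> s x = s y) \/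
  exists k, E0_embedding k.
Proof.
case: (pselect (small setT)) => [/small_selector|nT]; [by left|right].
have [F0 [G0 [e0 cod0]]] := codT; have [U [oU bU]] := basisT.
pose B p := if @unpickle (nat * nat)%type p is Some mi then g mi.1 @^-1` U mi.2
    else set0.
have [F [G [e [cod clo]]]] : exists F G e, coding F G e /\ forall i,
    clopenB F (G @^-1` B i).
  apply: (coding_clopen sepT cod0) => i; rewrite /B; case: unpickle => [[m j]|].
    exact: bg.
  exact: (sa_cst saT False).
apply: (embed_E0 cod) nT => m z Fz V oV Vz.
have [i [Ui UV]] := bU _ _ oV Vz.
have [n hn] := clo (pickle (m, i)) z Fz; exists n => w Fw zw; apply: UV.
by have := hn w Fw zw; rewrite /B pickleK /= => -[h _]; exact: h.
Qed.

End Transversals.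

(** * Borel maps into the Cantor space *)

Section CantorTopology.

Lemma coord_open (i : nat) (a : bool) : open [set b : cantor_space | b i = a].
Proof.
have /continuousP h : continuous (fun b : cantor_space =>
    b i) by exact: proj_continuous.
by have := h [set a]; apply; exact: discrete_open.
Qed.

Lemma cylinder_open (b : nat -> bool) n : open [set b' : cantor_space | agree n
    b b'].
Proof.
elim: n => [|n IH].
  have -> : [set b' : cantor_space | agree 0 b b'] = setT by apply/seteqP; split.
  exact: openT.
have -> : [set b' : cantor_space | agree n.+1 b b'] =
    [set b' : cantor_space | agree n b b'] `&` [set b' : cantor_space | b' n = b n].
  apply/seteqP; split => c /=.
    by move=> h; split; [exact: agree_le h|rewrite h].
  case=> h1 h2 i; rewrite ltnS leq_eqVlt => /predU1P[->//|]; exact: h1.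
exact: openI IH (coord_open _ _).
Qed.

(** The filter generated by the cylinders around [b] converges to [b] coordinatewise. *)
Lemma open_cylinder (V : set cantor_space) (b : cantor_space) :
  open V -> V b -> exists n, forall b' : cantor_space, agree n b b' -> V b'.
Proof.
move=> oV Vb.
pose F : set_system (nat -> bool) := [set A | exists n, forall b',
    agree n b b' -> A b'].
have FF : Filter F.
  split; first by exists 0%N.
  - move=> A B [n hn] [m hm]; exists (maxn n m) => b' h; split.
      by apply: hn; apply: agree_le h; exact: leq_maxl.
    by apply: hm; apply: agree_le h; exact: leq_maxr.
  - by move=> A B AB [n hn]; exists n => b' /hn /AB.
have : F --> (b : cantor_space).
  apply/cvg_sup => i; apply/cvg_image.
    by apply/seteqP; split => // a _; exists (fun=> a).
  move=> A /nbhs_singleton Ab; exists [set b' : nat -> bool | A (b' i)].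
    by exists i.+1 => b' /(_ i (ltnSn i)) /= <-.
  by apply/seteqP; split => [a [c Ac <-]//|a Aa]; exists (fun=> a).
by move/(_ V); apply; apply: open_nbhs_nbhs.
Qed.

Lemma borel_cantor_map (X : Type) (S : set (set X)) (f : X -> cantor_space) :
  sigma_algebra setT S -> (forall n a, S [set x | f x n = a]) ->
  forall V, <<s @open cantor_space >> V -> S (f @^-1` V).
Proof.
move=> saS bf; apply: borel_comp_gen => // V oV.
apply: (@sa_ext _ S (fun x => exists n : nat, forall b' : cantor_space,
    agree n (f x) b' -> V b')).
  by move=> x; split => [[n h]|Vx]; [exact: h|exact: open_cylinder].
apply: (sa_ex saS) => n.
apply: (sa_agree (A := bool) (P := fun b => forall b' : cantor_space,
    agree n b b' -> V b') saS bf (n := n)).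
by move=> z w zw h v wv; apply: h; exact: agree_trans wv.
Qed.

End CantorTopology.

(** * The Baire property on binary sequences *)

Section BaireProperty.
Let C := nat -> bool.

Definition nowhere_dense (A : set C) : Prop := forall b n, exists b' n',
  [/\ (n <= n')%N, agree n b b' & forall c, agree n' b' c -> ~ A c].

Definition meager (A : set C) : Prop := exists D : nat -> set C,
  (forall i, nowhere_dense (D i)) /\ forall c, A c -> exists i, D i c.

Lemma nowhere_dense0 : nowhere_dense set0.
Proof. by move=> b n; exists b, n; split => // c _ []. Qed.

Lemma meager_ideal : sigma_ideal meager.
Proof.
split.
- by exists (fun=> set0); split => // i; exact: nowhere_dense0.
- by move=> A B AB [D [nD h]]; exists D; split => // c /AB /h.
- move=> A /choice[D hD].
  exists (fun p => if @unpickle (nat * nat)%type p is Some mn then D mn.1 mn.2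
      else set0); split.
    move=> i; case: unpickle => [[m n]|]; last exact: nowhere_dense0.
    by case: (hD m).
  move=> c [m _ Ac]; have [_ /(_ c Ac)[n Dc]] := hD m.
  by exists (pickle (m, n)); rewrite pickleK.
Qed.

Lemma nowhere_dense_meager A : nowhere_dense A -> meager A.
Proof. by move=> nA; exists (fun=> A); split => // c Ac; exists 0%N. Qed.

(** The Baire category theorem for binary sequences. *)
Lemma cylinder_nonmeager b n : ~ meager [set c | agree n b c].
Proof.
move=> [D [nD cov]].
pose Q i (s s' : C * nat) := [/\ (s.2 < s'.2)%N, agree s.2 s.1 s'.1 &
  forall c, agree s'.2 s'.1 c -> ~ D i c].
have [|i [b1 n1] _|st [st0 _ hQ]] := @dep_choice _ (fun _ _ => True) Q (b, n) => //.
  have [b2 [n2 [n12 b12 h]]] := nD i b1 n1.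
  exists (b2, n2.+1); split => //; split => //= c h'.
  by apply: h; exact: agree_le h'.
have stn i : (i <= (st i).2)%N.
  by elim: i => // i IH; case: (hQ i) => h _ _; exact: leq_ltn_trans h.
have lim i : agree (st i).2 (diagonal (fun i => (st i).1)) (st i).1.
  apply: (@diagonal_agree _ (fun i => (st i).1) (fun i => (st i).2)) => // j.
    by case: (hQ j) => /ltnW.
  by case: (hQ j).
have [|i Di] := cov (diagonal (fun i => (st i).1)).
  by have := lim 0%N; rewrite st0 => /agree_sym.
case: (hQ i) => _ _ /(_ (diagonal (fun i => (st i).1))); apply => //.
exact/agree_sym/lim.
Qed.

(** Weaker in form than being equal to an open set up to a meager one, but it defines
a sigma-algebra by a short argument, and it is what [no_flip_set] uses. *)
Definition baire_property (S : set C) : Prop := forall b n, exists b' n',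
  [/\ (n <= n')%N, agree n b b' & meager [set c | agree n' b' c /\ S c] \/
    meager [set c | agree n' b' c /\ ~ S c]].

Let cyl (s : seq bool) : set C := [set c | agree (size s) (nth false s) c].

Let cylP b n : exists s, size s = n /\ agree n (nth false s) b.
Proof.
exists (mkseq b n); rewrite size_mkseq; split => // i ni.
by rewrite nth_mkseq.
Qed.

(** The Banach category argument: up to a nowhere dense set, [S] is covered in the cylinder
by the cylinders in which it is meager, and there are countably many of them. *)
Lemma locally_meager b n (S : set C) :
  (forall b' n', (n <= n')%N -> agree n b b' -> exists b'' n'',
    [/\ (n' <= n'')%N, agree n' b' b'' & meager [set c | agree n'' b'' c /\
        S c]]) ->
  meager [set c | agree n b c /\ S c].
Proof.
move=> hS; apply: contrapT => nm.
pose ok (s : seq bool) := meager [set c | cyl s c /\ S c].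
pose B (j : option (seq bool)) : set C :=
  if j is Some s then [set c | ok s /\ cyl s c] else [set c | forall s, ok s ->
      ~ cyl s c].
have [|[s|]] := sideal_split meager_ideal (B := B) nm.
- move=> c _; case: (pselect (exists s, ok s /\ cyl s c)) => [[s h]|h].
    by exists (Some s).
  by exists None => s oks cs; apply: h; exists s.
- case: (pselect (ok s)) => oks; apply.
    by apply: (sideal_sub meager_ideal) oks => c [[_ Sc] [_ cc]].
  by apply: (sideal_sub meager_ideal) (sideal0 meager_ideal) => c [_ []].
- apply; apply: nowhere_dense_meager => b1 n1.
  case: (pselect (agree (minn n n1) b b1)) => [bb1|nbb1]; last first.
    exists b1, n1; split => // c b1c [[bc _] _]; apply: nbb1.
    apply: agree_trans (agree_le (geq_minl _ _) bc) _; apply: agree_sym.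
    exact: agree_le (geq_minr _ _) b1c.
  pose b2 i := if (i < n1)%N then b1 i else b i.
  have b12 : agree n1 b1 b2 by move=> i; rewrite /b2 => ->.
  have bb2 : agree n b b2.
    move=> i ni; rewrite /b2; case: ifP => // i1; apply: bb1.
    by rewrite leq_min ni.
  have [b3 [n3 [n23 b23 m3]]] := hS b2 (maxn n n1) (leq_maxl _ _) bb2.
  have [s [sn sb]] := cylP b3 n3.
  exists b3, n3; split.
  + by apply: leq_trans n23; exact: leq_maxr.
  + by apply: agree_trans b12 _; apply: agree_le b23; exact: leq_maxr.
  + move=> c b3c [_ /(_ s)]; apply.
      apply: (sideal_sub meager_ideal) m3 => c' [h1 h2]; split => //.
      by apply: agree_trans (agree_sym sb) _; rewrite -sn.
    by rewrite /cyl /= sn; apply: agree_trans sb b3c.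
Qed.

(** For a countable union, either some member is comeager in a smaller cylinder, or all
members are locally meager, and then so is the union. *)
Lemma sa_baire_property : sigma_algebra setT baire_property.
Proof.
split.
- move=> b n; exists b, n; split => //; left.
  by apply: (sideal_sub meager_ideal) (sideal0 meager_ideal) => c [].
- move=> S bS b n; have [b' [n' [nn' bb' h]]] := bS b n; exists b', n'; split => //.
  case: h => h; [right|left]; apply: (sideal_sub meager_ideal) h => c [h1 h2];
      split => //.
    by apply: contrapT => nS; apply: h2; split.
  by case: h2.
- move=> S bS b n.
  case: (pselect (exists i b' n', [/\ (n <= n')%N, agree n b b' &
      meager [set c | agree n' b' c /\ ~ S i c]])).
    move=> [i [b' [n' [nn' bb' h]]]]; exists b', n'; split => //; right.
    apply: (sideal_sub meager_ideal) h => c [h1 h2]; split => // Sc.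
    by apply: h2; exists i.
  move=> h; exists b, n; split => //; left.
  apply: (sideal_sub meager_ideal) (sideal_cup meager_ideal (B := fun i =>
      [set c | agree n b c /\ S i c]) _).
    by move=> c [bc [i _ Sc]]; exists i.
  move=> i; apply: locally_meager => b' n' nn' bb'.
  have [b'' [n'' [n12 b12 [m|m]]]] := bS i b' n'; first by exists b'', n''.
  case: h; exists i, b'', n''; split => //; first exact: leq_trans n12.
  by apply: agree_trans bb' _; exact: agree_le b12.
Qed.

Lemma open_baire_property (S : set C) :
  (forall b, S b -> exists n, forall c, agree n b c -> S c) -> baire_property S.
Proof.
move=> oS b n; case: (pselect (exists c, agree n b c /\ S c)) => [[c [bc Sc]]|nS].
  have [m hm] := oS c Sc; exists c, (maxn n m); split => //; first exact: leq_maxl.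
  right; apply: (sideal_sub meager_ideal) (sideal0 meager_ideal) => c' [cc' nSc'].
  by apply: nSc'; apply: hm; apply: agree_le cc'; exact: leq_maxr.
exists b, n; split => //; left.
apply: (sideal_sub meager_ideal) (sideal0 meager_ideal) => c hc.
by apply: nS; exists c.
Qed.

Definition flip (j : nat) (b : C) : C := fun i => b i (+) (i == j).

Lemma flipK j b : flip j (flip j b) = b.
Proof. by apply/funext => i; rewrite /flip -addbA addbb addbF. Qed.

Lemma flip_agree j n b c : agree n b c -> agree n (flip j b) (flip j c).
Proof. by move=> h i ni; rewrite /flip h. Qed.

Lemma meager_flip j A : meager A -> meager (flip j @^-1` A).
Proof.
move=> [D [nD cov]]; exists (fun i => flip j @^-1` (D i)); split; last first.
  by move=> c /cov[i Di]; exists i.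
move=> i b n; have [b' [n' [nn' bb' h]]] := nD i (flip j b) n.
exists (flip j b'), n'; split => //; first by rewrite -[b](flipK j);
    exact: flip_agree.
by move=> c bc; apply: h; rewrite -[b'](flipK j); exact: flip_agree.
Qed.

(** In some cylinder the set or its complement is meager; flipping a bit beyond the fixed
ones preserves the cylinder and exchanges them, so both are meager there. *)
Theorem no_flip_set (S : set C) : baire_property S ->
  ~ (forall j b, S (flip j b) <-> ~ S b).
Proof.
move=> bS fS; have [b [n [_ _ h]]] := bS (fun=> false) 0%N.
have fcyl c : agree n b c -> agree n b (flip n c).
  move=> bc i ni; rewrite /flip (ltn_eqF ni) addbF; exact: bc.
have [m1 m2] : meager [set c | agree n b c /\ S c] /\
    meager [set c | agree n b c /\ ~ S c].
  case: h => h; split => //; have := meager_flip n h;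
      apply: (sideal_sub meager_ideal) => c [bc Sc]; split.
  - exact: fcyl.
  - exact/fS.
  - exact: fcyl.
  - by move=> /fS.
apply: (@cylinder_nonmeager b n).
apply: (sideal_sub meager_ideal) (sideal_cup meager_ideal
  (B := fun i => if i is 0 then [set c | agree n b c /\
      S c] else [set c | agree n b c /\ ~ S c]) _).
  by move=> c bc; case: (pselect (S c)) => Sc; [exists 0%N|exists 1%N].
by case.
Qed.

End BaireProperty.

(** * A Borel homomorphism back to eventual equality *)

Section Retraction.
Variable T : topologicalType.
Hypothesis sepT : point_separated T.
Let saT : sigma_algebra setT (borel_sets T) := borelP T.
Variable E : T -> T -> Prop.
Hypothesis equivE : RelationClasses.Equivalence E.
Variable g : nat -> T -> T.
Hypothesis bg : forall n, borel_map (g n).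
Hypothesis gE : forall n x, E x (g n x).
Hypothesis Eg : forall x y, E x y -> exists n, y = g n x.
Variable k : (nat -> bool) -> T.
Hypothesis k_cont : forall b U, open U -> U (k b) ->
  exists n, forall b', agree n b b' -> U (k b').
Hypothesis k_red : forall b b', E (k b) (k b') -> eventually_eq b b'.
Hypothesis k_inj : injective k.

Let Erefl x : E x x. Proof. by case: equivE. Qed.
Let Esym x y : E x y -> E y x. Proof. by case: equivE => _ + _; apply. Qed.
Let Etrans x y z : E x y -> E y z -> E x z.
Proof. by case: equivE => _ _; apply. Qed.

(** The image is compact, as the Cantor space is. *)
Lemma image_borel (A : set cantor_space) : closed A -> borel_sets T (k @` A).
Proof.
move=> cA; rewrite -[X in borel_sets _ X]setCK.
have : closed (k @` A).
  apply: compact_closed.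
    rewrite open_hausdorff => x y /eqP /sepT[U [V [oU oV Ux Vy UV]]].
    exists (U, V); first by rewrite !inE.
    split => //; apply/eqP/seteqP; split => // t [/= Ut /(UV t Ut)].
    by [].
  apply: (@continuous_compact cantor_space T).
    apply: continuous_subspaceT; apply/continuousP => V oV; rewrite openE =>
        b /= Vb.
    have [n hn] := k_cont oV Vb.
    apply: filterS (open_nbhs_nbhs (conj (cylinder_open b n) (@agree_refl _ n b))).
    by move=> b' /hn.
  exact: subclosed_compact cA cantor_space_compact _.
move=> cK; apply: (sa_not saT); apply: borel_open.
by rewrite openC.
Qed.

Let K := k @` setT.

(** A point of the saturation of the range of [k] is moved into the range by the first
possible function [g m], and then pulled back along [k]; all the other points are
sent to the zero sequence. *)
Theorem retraction : exists r : T -> nat -> bool,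
  [/\ forall n a, borel_sets T [set x | r x n = a],
      forall x y, E x y -> eventually_eq (r x) (r y) &
      forall b, eventually_eq (r (k b)) b].
Proof.
have bK : borel_sets T K by apply: image_borel; exact: closedT.
pose K1 j := k @` [set b : cantor_space | b j = true].
have bK1 j : borel_sets T (K1 j).
  apply: image_borel; rewrite -[X in closed X]setCK; apply: open_closedC.
  have -> : ~` [set b : cantor_space | b j = true] = [set b : cantor_space | b
      j = false].
    by apply/seteqP; split => b /=; [move/negP/negbTE|move=> ->].
  exact: coord_open.
pose N x := least (fun m => K (g m x)).
have /choice[r hr] : forall x, exists b, ((exists m, K (g m x)) ->
    k b = g (N x) x) /\
    ((forall m, ~ K (g m x)) -> b = fun=> false).
  move=> x; case: (pselect (exists m, K (g m x))) => [[m Km]|nK].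
    have [b _ kb] : K (g (N x) x) by apply: (@leastP (fun m => K (g m x)) m).
    by exists b; split => // /(_ m).
  by exists (fun=> false).
exists r; split.
- suff h n : borel_sets T [set x | r x n = true].
    move=> n [|] //; apply: (@sa_ext _ (borel_sets T) (fun x => ~ (r x n = true))).
      by move=> x; case: (r x n); split.
    exact: (sa_not saT).
  apply: (@sa_ext _ (borel_sets T) (fun x => (exists m, K (g m x)) /\ exists m,
      N x = m /\ K1 n (g m x))).
    move=> x; have [r1 r0] := hr x; split.
      by move=> [/r1 kr [m [Nm [b bn kb]]]]; rewrite -Nm -kr in kb;
          rewrite -(k_inj kb).
    case: (pselect (exists m, K (g m x))) => [ex rn|nK].
      by split => //; exists (N x); split => //; exists (r x) => //; exact: r1.
    by rewrite r0// => m Km; apply: nK; exists m.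
  have bKg m : borel_sets T [set x | K (g m x)] by exact: (borel_map_pre (bg m) bK).
  apply: (sa_and saT); first by apply: (sa_ex saT).
  apply: (sa_ex saT) => m; apply: (sa_and saT); first exact: (sa_least saT).
  exact: (borel_map_pre (bg m) (bK1 n)).
- move=> x y Exy; have [r1 r0] := hr x; have [s1 s0] := hr y.
  have Kiff u v : E u v -> (exists m, K (g m u)) -> exists m, K (g m v).
    move=> Euv [m Km]; have [l hl] := Eg (Etrans (Esym Euv) (gE m u)).
    by exists l; rewrite -hl.
  case: (pselect (exists m, K (g m x))) => ex.
    apply: k_red; rewrite r1// s1; last exact: Kiff ex.
    by apply: Etrans (gE _ y); apply: Etrans Exy; apply: Esym; exact: gE.
  exists 0%N => i _; rewrite r0; last by move=> m Km; apply: ex; exists m.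
  rewrite s0 // => m Km; apply: ex; apply: (Kiff y) => //; first exact: Esym.
  by exists m.
- move=> b; have [r1 _] := hr (k b); apply: k_red; rewrite r1.
    exact/Esym/gE.
  have [m hm] := Eg (Erefl (k b)).
  by exists m; rewrite -hm; exists b.
Qed.

End Retraction.


(** * The family of parity sets *)

Lemma finite_nat_bound (A : set nat) :
  finite_set A <-> exists N, forall m, A m -> (m < N)%N.
Proof.
split=> [/finite_seqP[s ->]|[N hN]].
  exists (\max_(i <- s) i).+1 => m /= ms.
  by rewrite ltnS; apply: (@leq_bigmax_seq _ s xpredT id m ms).
by apply: sub_finite_set (finite_II N) => m /hN.
Qed.

Fixpoint parity (b : nat -> bool) (n : nat) : bool :=
  if n is m.+1 then parity b m (+) b m else false.

Lemma parity_agree b b' n : agree n b b' -> parity b n = parity b' n.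
Proof.
elim: n => //= n IH h; rewrite (h n)// IH//; exact: agree_le h.
Qed.

Lemma parity_eventually b b' n : (forall i, (n <= i)%N -> b i = b' i) ->
  forall m, (n <= m)%N -> parity b' m = parity b m (+) (parity b n (+) parity b' n).
Proof.
move=> bb m /subnKC <-; elim: (m - n)%N => [|d IH].
  by rewrite addn0 addbA addbb.
by rewrite addnS /= IH bb ?leq_addr// addbAC.
Qed.

Lemma parity_flip j b m : (j < m)%N -> parity (flip j b) m = ~~ parity b m.
Proof.
elim: m => // m IH; rewrite ltnS leq_eqVlt => /predU1P[<-|jm] /=.
  rewrite /flip eqxx addbT -(@parity_agree b); first by case: parity; case: (b j).
  by move=> i ij; rewrite (ltn_eqF ij) addbF.
by rewrite IH// /flip (gtn_eqF jm) addbF; case: parity; case: (b m).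
Qed.

(** [m./2] is used with [odd m] to record the parities on the even numbers and their
negations on the odd ones: the set is then infinite and co-infinite for every [b].
The bit [c] complements it and the string [w] prescribes an initial segment. *)
Definition parity_mem (b : nat -> bool) (c : bool) (w : seq bool) (m : nat) :
    bool :=
  if (m < size w)%N then nth false w m else parity b m./2 (+) odd m (+) c.

Definition parity_set b c w : set nat := [set m | parity_mem b c w m].

Lemma parity_set_infinite b c w : infinite_set (parity_set b c w).
Proof.
move=> /finite_nat_bound[N hN].
pose n := maxn N (size w).
have big a m : (m <= n)%N -> (n.*2 + a < m)%N = false.
  by move=> mn; apply/negbTE; rewrite -leqNgt (leq_trans mn)// -addnn -addnA
      leq_addr.
have wn a : (n.*2 + a < size w)%N = false by apply: big; exact: leq_maxr.
have Nn a : (n.*2 + a < N)%N = false by apply: big; exact: leq_maxl.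
have := hN (n.*2 + 0)%N; have := hN (n.*2 + 1)%N;
    rewrite !Nn /parity_set /= /parity_mem !wn.
rewrite addn0 addn1 /= odd_double doubleK uphalf_double addbF addbT addNb.
by case: (parity b n (+) c) => [_ /(_ isT)|/(_ isT)].
Qed.

(** As [p] varies this enumerates all finite modifications of the parity set of [b] and of
its complement. *)
Definition parity_infset b (p : nat) : infset :=
  let cw := odflt (false, [::]) (@unpickle (bool * seq bool)%type p) in
  exist _ (parity_set b cw.1 cw.2) (@parity_set_infinite b cw.1 cw.2).

Lemma infset_eq (A B : infset) : sval A = sval B -> A = B.
Proof.
case: A B => [A iA] [B iB] /= AB; subst B; congr exist; exact: Prop_irrelevance.
Qed.

(** The two parity sets agree or are complementary beyond the point [n] where the sequences
become equal, depending on the parity of the number of differences; what happens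
before is absorbed in the prescribed initial segment. *)
Lemma parity_range_sub b b' : eventually_eq b b' ->
  range (parity_infset b) `<=` range (parity_infset b').
Proof.
move=> [n hn] _ [p _ <-].
pose cw := odflt (false, [::]) (@unpickle (bool * seq bool)%type p).
pose L := maxn n.*2 (size cw.2).
pose d := parity b n (+) parity b' n.
exists (pickle (cw.1 (+) d, mkseq (parity_mem b cw.1 cw.2) L)) => //.
apply: infset_eq; rewrite /parity_infset pickleK /= -/cw.
apply/seteqP; suff h m : parity_mem b' (cw.1 (+) d) (mkseq (parity_mem b cw.1
    cw.2) L) m = parity_mem b cw.1 cw.2 m.
  by split => m /=; rewrite /parity_set /= h.
rewrite {1}/parity_mem size_mkseq; case: ltnP => mL; first by rewrite nth_mkseq.
have nm : (n <= m./2)%N.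
  by rewrite -[n]doubleK; apply: half_leq; apply: leq_trans mL; exact: leq_maxl.
rewrite /parity_mem ltnNge (leq_trans _ mL) ?leq_maxr//=.
rewrite (parity_eventually hn nm) -/d.
by case: (parity b _); case: d; case: (odd m); case: cw.1.
Qed.

Lemma eventually_eq_sym b b' : eventually_eq b b' -> eventually_eq b' b.
Proof. by move=> [n hn]; exists n => i /hn. Qed.

Lemma parity_range b b' : eventually_eq b b' ->
  E_set (parity_infset b) (parity_infset b').
Proof.
move=> h; apply/seteqP; split; apply: parity_range_sub => //.
exact: eventually_eq_sym.
Qed.

Lemma almost_subsetP (A B : set nat) :
  almost_subset A B <-> exists N, forall m, (N <= m)%N -> A m -> B m.
Proof.
rewrite /almost_subset; split => [/finite_nat_bound[N hN]|[N hN]].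
  exists N => m Nm Am; apply: contrapT => nB.
  by have := hN m (conj Am nB); rewrite ltnNge Nm.
apply/finite_nat_bound; exists N => m [Am nB]; rewrite ltnNge; apply/negP => Nm.
by apply: nB; exact: hN.
Qed.

Lemma infset_unbounded (A : infset) N : exists m, (N <= m)%N /\ sval A m.
Proof.
case: A => A iA /=; apply: contrapT => h; apply: iA; apply/finite_nat_bound.
by exists N => m Am; rewrite ltnNge; apply/negP => Nm; apply: h; exists m.
Qed.

Lemma infset_coord_borel m : infset_borel [set A | sval A m].
Proof.
exists [set b : cantor_space | b m = true].
  by apply: sub_sigma_algebra; exact: coord_open.
by rewrite setTI; apply/seteqP; split => A /= /asboolP.
Qed.

(** * Non-smooth relations are splitting *)

Section Contradiction.
Variables (X : Type) (BX : set (set X)) (E : X -> X -> Prop).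
Hypothesis saX : sigma_algebra setT BX.
Variables (r : X -> nat -> bool) (k : (nat -> bool) -> X).
Hypothesis r_borel : forall n a, BX [set x | r x n = a].
Hypothesis r_hom : forall x y, E x y -> eventually_eq (r x) (r y).
Hypothesis k_bp : forall A, BX A -> baire_property (k @^-1` A).
Hypothesis k_hom : forall b b', eventually_eq b b' -> E (k b) (k b').
Hypothesis rk : forall b, eventually_eq (r (k b)) b.

(** The family of parity sets of [r x] is a homomorphism; an unsplit choice [psi] would give
a set [S] of sequences, those whose parity set almost contains the choice, that has
the Baire property and is complemented by every bit flip. *)
Theorem splitting_of_E0 : ~ borel_non_splitting BX E.
Proof.
move=> hs.
pose phi x := parity_infset (r x).
have [|psi [[bpsi hpsi] dec]] := hs phi.
  split; last by move=> x y /r_hom; exact: parity_range.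
  apply: borel_comp_gen => // _ [p _ [_ [V bV <-] <-]]; rewrite !setTI.
  apply: (@borel_cantor_map X BX (fun x =>
      indicator_seq (phi x p)) saX _ V bV) => n a.
  rewrite /phi /parity_infset.
  set cw := odflt _ _; pose P (b : nat -> bool) :=
      indicator_seq (exist _ (parity_set b cw.1 cw.2) (@parity_set_infinite b
      cw.1 cw.2)) n = a.
  apply: (sa_agree (A := bool) (P := P) saX r_borel (n := n./2)).
  move=> z w zw; rewrite /P /indicator_seq /= /parity_set /= /parity_mem.
  by rewrite (parity_agree zw).
pose Ab b := parity_set b false [::].
have AbE b m : Ab b m <-> parity b m./2 (+) odd m.
  by rewrite /Ab /parity_set /= /parity_mem ltn0 addbF.
pose S : set (nat -> bool) := [set b | exists N, forall m, (N <= m)%N ->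
    sval (psi (k b)) m -> Ab b m].
(* Although [phi (k b)] is built from [r (k b)], the parity set of [b] itself is among its
   members. *)
have decS b : S b \/ exists N, forall m, (N <= m)%N -> sval (psi (k b)) m ->
    ~ Ab b m.
  have : range (parity_infset b) (parity_infset b (pickle (false,
      [::] : seq bool))) by exists (pickle (false, [::] : seq bool)).
  rewrite -(parity_range (rk b)) => -[p _ ep].
  have := dec (k b) p; rewrite /phi ep {1 2}/parity_infset pickleK /=.
  by case => /almost_subsetP h; [left|right].
have Sexcl b N : S b -> ~ (forall m, (N <= m)%N -> sval (psi (k b)) m -> ~ Ab b m).
  move=> [M hM] hN; have [m [Mm pm]] := infset_unbounded (psi (k b)) (maxn M N).
  move: Mm; rewrite geq_max => /andP[Mm Nm].
  exact: (hN m Nm pm (hM m Mm pm)).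
have bpS : baire_property S.
  have sab := sa_baire_property.
  apply: (sa_ex sab) => N; apply: (sa_all sab) => m; apply: (sa_imp sab);
      first exact: (sa_cst sab).
  apply: (sa_imp sab).
    apply: (k_bp (A := [set x | sval (psi x) m])).
    exact: (bpsi _ (infset_coord_borel m)).
  apply: open_baire_property => b Abm; exists m./2 => c bc.
  by move: Abm => /AbE; rewrite (parity_agree bc) => /AbE.
apply: (no_flip_set bpS) => j b.
have psieq : exists N, forall m, (N <= m)%N -> sval (psi (k b)) m <->
    sval (psi (k (flip j b))) m.
  have : E0_infset (psi (k b)) (psi (k (flip j b))).
    apply: hpsi; apply: k_hom; exists j.+1 => i ji.
    by rewrite /flip (gtn_eqF ji) addbF.
  move=> /finite_nat_bound[N hN]; exists N => m Nm.
  have nd : ~ (sval (psi (k b)) `+` sval (psi (k (flip j b)))) m.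
    by move=> /hN; rewrite ltnNge Nm.
  split => h; apply: contrapT => h'; apply: nd; first by left.
  by right.
have [N hN] := psieq.
have Aflip m : (j.+1.*2 <= m)%N -> Ab (flip j b) m <-> ~ Ab b m.
  move=> jm; have jm2 : (j < m./2)%N by rewrite -[j.+1]doubleK; exact: half_leq.
  split.
    by move=> /AbE; rewrite parity_flip// => h /AbE; move: h; case: parity;
        case: odd.
  by move=> /AbE nA; apply/AbE; rewrite parity_flip//; move: nA; case: parity;
      case: odd.
split=> [[M hM] Sb|nSb].
  apply: (Sexcl b (maxn (maxn N M) j.+1.*2) Sb) => m.
  rewrite !geq_max => /andP[/andP[Nm Mm] jm] pm.
  by apply/Aflip => //; apply: hM => //; apply/hN.
case: (decS b) => // -[M hM].
exists (maxn (maxn N M) j.+1.*2) => m.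
rewrite !geq_max => /andP[/andP[Nm Mm] jm] pm.
by apply/Aflip => //; apply: hM => //; apply/hN.
Qed.

End Contradiction.

(** If [E] is not smooth, [smooth_or_embeds_E0] and [retraction] produce the two maps of
[splitting_of_E0]. *)
Lemma selector_of_non_splitting (R : realType) (M : metricType R) (E : M -> M ->
    Prop) :
  complete_separable M -> countable_borel_equivalence (borel_sets M) E ->
  borel_non_splitting (borel_sets M) E ->
  exists s : M -> M, borel_map s /\ forall x y, E x y <-> s x = s y.
Proof.
move=> cM [equivE bE cE] hs.
have [Erefl Esym Etrans] := equivE.
case: (pselect (exists x0 : M, True)) => [[x0 _]|nM]; last first.
  exists id; split; first exact: borel_map_id.
  by move=> x; case: nM; exists x.
have sepM := @separated_metric R M.
have codM := coding_metric cM x0; have basM := countable_basis cM x0.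
have [u [bu hu]] := lusin_novikov sepM codM basM bE cE.
pose g n : M -> M := if n is m.+1 then
  (fun x => if pselect (E x (u m x)) then u m x else x) else id.
have bg n : borel_map (g n).
  case: n => [|m]; first exact: borel_map_id.
  apply: (borel_map_if (P := [set x | E x (u m x)])) => //;
      last exact: borel_map_id.
  apply: (@borel_comp_gen _ _ (borel_sets M) _ (fun x => (x,
      u m x)) (borelP M) _ _ bE).
  move=> _ [A bA [B bB <-]].
  exact: (sa_and (borelP M) bA (borel_map_pre (bu m) bB)).
have g0 x : g 0%N x = x by [].
have gE n x : E x (g n x) by case: n => [|m] /=; [exact: Erefl|case: pselect].
have Eg x y : E x y -> exists n, y = g n x.
  by move=> Exy; have [m ym] := hu x y Exy; exists m.+1; rewrite /g -ym;
      case: pselect.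
have [//|[k [kc kh kr ki]]] := smooth_or_embeds_E0 sepM codM basM equivE bg g0
    gE Eg.
have [r [br rh rk]] := retraction sepM equivE bg gE Eg kc kr ki.
exfalso; apply: (splitting_of_E0 (borelP M) br rh _ kh rk hs).
  apply: (borel_comp_gen sa_baire_property) => U oU;
      apply: open_baire_property => b.
  exact: kc.
Qed.

Theorem theorem6p1 (R : realType) (X : Type) (BX : set (set X))
    (E : X -> X -> Prop) (hX : standard_borel R BX)
    (hE : countable_borel_equivalence BX E) (hs : borel_non_splitting BX E) :
  smooth R BX E.
Proof.
have [M [f [cM [f' fK f'K] BXE]]] := hX.
have bf V : borel_sets M V -> BX (f @^-1` V) by move=> bV; rewrite BXE;
    exists V => //; rewrite setTI.
have bf' A : BX A -> borel_sets M (f' @^-1` A).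
  rewrite BXE => -[V bV <-]; rewrite setTI.
  by apply: (@sa_ext _ (borel_sets M) V) bV => y /=; rewrite f'K.
pose E' y y' := E (f' y) (f' y').
have [[Erefl Esym Etrans] bE cE] := hE.
have [||s [bs hs']] := @selector_of_non_splitting R M E' cM.
- split.
  + by split; [move=> x; exact: Erefl|move=> x y; exact: Esym|move=> x y z;
      exact: Etrans].
  + have saP : sigma_algebra setT (prod_borel (borel_sets M) (borel_sets M)) by
      exact: smallest_sigma_algebra.
    apply: (@borel_comp_gen _ _ _ _ (fun p => (f' p.1, f' p.2)) saP _ _ bE).
    move=> _ [A bA [B bB <-]]; apply: sub_sigma_algebra.
    by exists (f' @^-1` A); [exact: bf'|exists (f' @^-1` B); [exact: bf'|]].
  + move=> y; have /countable_injP[h hi] := cE (f' y); apply/countable_injP.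
    exists (h \o f') => a b; rewrite !inE => Ea Eb /= hab.
    by rewrite -[a]f'K -[b]f'K; congr f; apply: hi; rewrite ?inE.
- move=> phi [bphi hphi].
  have [|psi [[bpsi hpsi] dec]] := hs (phi \o f).
    split; first by move=> U /bphi /bf.
    by move=> x x' Exx'; apply: hphi; rewrite /E' !fK.
  exists (psi \o f'); split; last first.
    by move=> y n; have := dec (f' y) n; rewrite /= f'K.
  by split; [move=> U /bpsi /bf'|move=> y y'; exact: hpsi].
exists M, (borel_sets M), (s \o f); split.
- by exists M, id; split => //; [exists id|apply/seteqP; split => V; [exists V;
    rewrite ?setTI|move=> [W bW <-]; rewrite setTI]].
- by move=> U bU; exact: (bf _ (borel_map_pre bs bU)).
- by move=> x x'; rewrite -hs' /E' !fK.
Qed.
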